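(* For $n\ge 0$ let $M_n$ be the thagomizer matroid and $P_n(t)$ its Kazhdan–Lusztig polynomial, let $c_{n,k}$ denote the coefficient of $t^k$ in $P_n(t)$, and set $\Phi(t,u):=\sum_{n=0}^\infty P_n(t)\,u^{n+1}\in\mathbb{Z}[t][[u]]$. The following (equivalent) statements hold. (1) For all $n\ge 0$ and $k\ge 0$, $c_{n,k}$ equals the number of Dyck paths of semilength $n$ with exactly $k$ long ascents. (2) As formal power series, \[\Phi(t,u)=\frac{1-\sqrt{1-4u(1-u+tu)}}{2(1-u+tu)},\] where the square root denotes the formal power series in $u$ with constant term $1$.
   Context: The thagomizer matroid $M_n$ is the graphic matroid (cycle matroid) of the graph obtained from the complete bipartite graph $K_{2,n}$, with parts $\{A,B\}$ and $\{1,\dots,n\}$, by adding an edge $AB$ between the two distinguished vertices $A,B$. Its ground set is the set of $2n+1$ edges and it has rank $n+1$ (for $n=0$ it is the matroid of a single edge $AB$, of rank $1$). For a matroid $M$ with lattice of flats $L(M)$ and flat $F$: the localization $M_F$ is the matroid on ground set $F$ whose lattice of flats is $\{G\in L(M): G\subseteq F\}$; the contraction $M^F$ is the matroid on $E\setminus F$ whose lattice of flats is $\{G\setminus F: G\in L(M), G\supseteq F\}$; $\chi_M(t)$ is the characteristic polynomial. The Kazhdan–Lusztig polynomial $P_M(t)\in\mathbb{Z}[t]$ is the unique assignment of polynomials to matroids such that: $P_M(t)=1$ if $\operatorname{rk}M=0$; $\deg P_M(t)<\tfrac12\operatorname{rk}M$ if $\operatorname{rk}M>0$; and for every $M$, $t^{\operatorname{rk}M}P_M(t^{-1})=\sum_{F\in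 L(M)}\chi_{M_F}(t)\,P_{M^F}(t)$. A Dyck path of semilength $n$ is a lattice path from $(0,0)$ to $(2n,0)$ using steps $u=(1,1)$ and $d=(1,-1)$ that never goes below the $x$-axis. A long ascent is a maximal run of consecutive $u$ steps of length at least $2$. *)

(* Defs.v *)
From HB Require Import structures.
From mathcomp Require Import all_boot all_order all_algebra.
From mathcomp Require Import boolp.

Set Implicit Arguments.
Unset Strict Implicit.
Unset Printing Implicit Defensive.

Import Order.TTheory GRing.Theory Num.Theory.

Local Open Scope ring_scope.

(* The ground set is a subset of an ambient finite type, so that the minors of
   a matroid on [T] are again matroids on [T]. *)
Record matroid (T : finType) := Matroid {
  ground : {set T};
  indep : {set {set T}};
  indep_ground : forall I, I \in indep -> I \subset ground;
  indep0 : set0 \in indep;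
  indepS : forall I J : {set T}, I \subset J -> J \in indep -> I \in indep;
  indep_aug : forall I J : {set T}, I \in indep -> J \in indep ->
    (#|I| < #|J|)%N -> exists2 e, e \in J :\: I & e |: I \in indep
}.

Lemma matroid_eq (T : finType) (M N : matroid T) :
  ground M = ground N -> indep M = indep N -> M = N.
Proof.
case: M N => [E I a b c d] [E' I' a' b' c' d'] /= eqE eqI.
by subst E' I'; congr Matroid; apply: Prop_irrelevance.
Qed.

Section MatroidTheory.
Variables (T : finType) (M : matroid T).
Implicit Types A B F G I J : {set T}.

Definition rk A : nat := \max_(I in indep M | I \subset A) #|I|.

Definition rank : nat := rk (ground M).

Definition cl A : {set T} := [set e in ground M | rk (e |: A) == rk A].

Definition flats : {set {set T}} :=
  [set F : {set T} | (F \subset ground M)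
           && [forall e in ground M :\: F, (rk F < rk (e |: F))%N]].

Lemma leq_rk A I : I \in indep M -> I \subset A -> (#|I| <= rk A)%N.
Proof.
move=> iI sIA.
by apply: (leq_bigmax_cond (F := fun I : {set T} => #|I|)); rewrite iI.
Qed.

Lemma rk_basis A : exists I, [/\ I \in indep M, I \subset A & #|I| = rk A].
Proof.
have [|I] := @eq_bigmax_cond _
   [pred I : {set T} | (I \in indep M) && (I \subset A)] (fun I => #|I|).
  by apply/card_gt0P; exists set0; rewrite inE /= indep0 sub0set.
rewrite inE => /andP[iI sIA] eqI; exists I; split=> //; rewrite -eqI.
Qed.

Lemma rkS A B : A \subset B -> (rk A <= rk B)%N.
Proof.
move=> sAB; have [I [iI sIA <-]] := rk_basis A.
by apply: leq_rk => //; apply: subset_trans sAB.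
Qed.

Lemma rk_ext A I : I \in indep M -> I \subset A ->
  exists X, [/\ X \in indep M, I \subset X, X \subset A & #|X| = rk A].
Proof.
have [n] := ubnP (rk A - #|I|); elim: n I => // n IHn I len iI sIA.
have := leq_rk iI sIA; rewrite leq_eqVlt => /orP[/eqP eqI|ltI].
  by exists I.
have [B [iB sBA cB]] := rk_basis A.
have [|e] := indep_aug iI iB; first by rewrite cB.
rewrite inE => /andP[nIe Be] iIe.
have [||X [iX sIX sXA cX]] := IHn _ _ iIe.
- by rewrite cardsU1 nIe add1n subnS prednK ?subn_gt0.
- by rewrite subUset sub1set (subsetP sBA).
- by exists X; split=> //; apply: subset_trans sIX; apply: subsetUr.
Qed.

Lemma rk_indep I : I \in indep M -> rk I = #|I|.
Proof.
move=> iI; apply/eqP; rewrite eqn_leq leq_rk // andbT.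
by have [J [iJ sJI <-]] := rk_basis I; apply: subset_leq_card.
Qed.

Lemma rk_card A : (rk A <= #|A|)%N.
Proof. by have [J [iJ sJI <-]] := rk_basis A; apply: subset_leq_card. Qed.

Lemma rk0 : rk set0 = 0%N.
Proof. by apply/eqP; rewrite -leqn0 (leq_trans (rk_card _)) ?cards0. Qed.

Lemma rkU_card A B : (rk (A :|: B) <= #|A| + rk B)%N.
Proof.
have [I [iI sI <-]] := rk_basis (A :|: B).
rewrite -(cardsID B I) addnC leq_add //.
  apply: subset_leq_card; apply/subsetP => e; rewrite inE => /andP[nBe Ie].
  by have:= subsetP sI e Ie; rewrite inE (negPf nBe) orbF.
apply: leq_rk; last exact: subsetIr.
by apply: indepS iI; apply: subsetIl.
Qed.

Lemma rk_submod A B : (rk (A :|: B) + rk (A :&: B) <= rk A + rk B)%N.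
Proof.
have [I [iI sI cI]] := rk_basis (A :&: B).
have sIU : I \subset A :|: B.
  by apply: subset_trans sI (subset_trans (subsetIl _ _) (subsetUl _ _)).
have [X [iX sIX sX cX]] := rk_ext iI sIU.
have h1 : (#|X :&: A| <= rk A)%N.
  by apply: leq_rk (subsetIr _ _); apply: indepS iX; apply: subsetIl.
have h2 : (#|X :&: B| <= rk B)%N.
  by apply: leq_rk (subsetIr _ _); apply: indepS iX; apply: subsetIl.
apply: leq_trans (leq_add h1 h2).
rewrite -cX -cI -[in leqRHS]cardsUI -setIUr (setIidPl sX) leq_add2l.
rewrite -setIIr subset_leq_card //.
by rewrite subsetI sIX; apply: subset_trans sI _.
Qed.

Lemma flatP F : reflect (F \subset ground M /\
  forall e, e \in ground M -> e \notin F -> (rk F < rk (e |: F))%N)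
  (F \in flats).
Proof.
rewrite inE; apply: (iffP andP) => [[sF /forall_inP fF]|[sF fF]]; split=> //.
  by move=> e Ee nFe; apply: fF; rewrite inE nFe.
by apply/forall_inP => e; rewrite inE => /andP[nFe Ee]; apply: fF.
Qed.

Lemma flat_ground F : F \in flats -> F \subset ground M.
Proof. by case/flatP. Qed.

Lemma groundF : ground M \in flats.
Proof. by apply/flatP; split=> // e ->. Qed.

Lemma flat_rk_lt F A : F \in flats -> F \proper A -> A \subset ground M ->
  (rk F < rk A)%N.
Proof.
case/flatP=> _ fF /properP[sFA [e Ae nFe]] sA.
apply: leq_trans (fF e _ nFe) _; first exact: (subsetP sA).
by apply: rkS; rewrite subUset sub1set Ae.
Qed.

Lemma flat_rk_le F A : F \in flats -> A \subset ground M -> (rk A <= rk (A :&: F))%N ->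
  A \subset F.
Proof.
case/flatP=> sF fF sA h; apply/subsetP => e Ae; apply: contraLR h => nFe.
rewrite -ltnNge; have := fF e (subsetP sA e Ae) nFe => lt1.
have := rk_submod (e |: (A :&: F)) F.
have -> : (e |: A :&: F) :|: F = e |: F.
  by apply/setP => x; rewrite !inE; case: (x == e); case: (x \in F); rewrite ?andbF ?andbT ?orbT ?orbF.
have -> : (e |: A :&: F) :&: F = A :&: F.
  apply/setP => x; rewrite !inE; case: eqP => [->|_]; rewrite ?(negPf nFe) ?andbF //=.
  by rewrite -andbA andbb.
have := @rkS (e |: (A :&: F)) A _.
rewrite subUset sub1set Ae subsetIl => /(_ isT) le1 le2.
apply: leq_trans le1.
rewrite -(ltn_add2r (rk F)); apply: leq_trans le2.
by rewrite addnC ltn_add2r.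
Qed.

Lemma cl0_flat : cl set0 \in flats.
Proof.
apply/flatP; split=> [|e Ee]; first by apply/subsetP => e; rewrite inE => /andP[].
have r0 : rk (cl set0) = 0%N.
  have [I [iI sI <-]] := rk_basis (cl set0).
  apply/eqP; rewrite cards_eq0 -subset0; apply/subsetP => x Ix.
  have := subsetP sI x Ix; rewrite inE => /andP[_]; rewrite rk0 setU0.
  rewrite rk_indep ?cards1 //.
  by apply: indepS iI; rewrite sub1set.
rewrite inE Ee /= r0 lt0n rk0 setU0; apply: contraNneq => h.
by rewrite -leqn0 -h rkS // sub1set setU11.
Qed.

Lemma rk_cl0 : rk (cl set0) = 0%N.
Proof.
have [I [iI sI <-]] := rk_basis (cl set0).
apply/eqP; rewrite cards_eq0 -subset0; apply/subsetP => x Ix.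
have := subsetP sI x Ix; rewrite inE => /andP[_]; rewrite rk0 setU0.
rewrite rk_indep ?cards1 //.
by apply: indepS iI; rewrite sub1set.
Qed.

Lemma cl0_sub F : F \in flats -> cl set0 \subset F.
Proof.
move=> fF; apply: flat_rk_le => //; last by rewrite rk_cl0.
exact: flat_ground cl0_flat.
Qed.

Lemma flat_rk0 F : F \in flats -> rk F = 0%N -> F = cl set0.
Proof.
move=> fF rF; apply/eqP; rewrite eqEsubset cl0_sub // andbT.
by apply: flat_rk_le; rewrite ?cl0_flat ?rF ?flat_ground.
Qed.

Lemma flatI F G : F \in flats -> G \in flats -> F :&: G \in flats.
Proof.
move=> fF fG; apply/flatP; split=> [|e Ee nFG].
  by apply: subset_trans (flat_ground fF); apply: subsetIl.
rewrite ltnNge; apply: contraNN nFG => le1.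
have sA : e |: F :&: G \subset ground M.
  rewrite subUset sub1set Ee; apply: subset_trans (flat_ground fF).
  exact: subsetIl.
have hF H : H \in flats -> F :&: G \subset H -> e \in H.
  move=> fH sH; have: e |: F :&: G \subset H.
    apply: flat_rk_le => //; apply: leq_trans le1 _; apply: rkS.
    by rewrite subsetI subsetUr.
  by rewrite subUset sub1set => /andP[].
by rewrite inE !hF // ?subsetIl ?subsetIr.
Qed.

End MatroidTheory.

(* [localization M F] is the matroid M_F, the restriction of [M] to [F], and
   [contraction M F] is the matroid M^F, often written M/F; their lattices of
   flats are given by [flats_localization] and [flats_contraction]. *)
Section Localization.
Variables (T : finType) (M : matroid T) (F : {set T}).

Definition localization_indep : {set {set T}} :=
  [set I in indep M | I \subset F].

Fact localization_indep_ground I :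
  I \in localization_indep -> I \subset ground M :&: F.
Proof. by rewrite inE subsetI => /andP[/indep_ground-> ->]. Qed.

Fact localization_indep0 : set0 \in localization_indep.
Proof. by rewrite inE indep0 sub0set. Qed.

Fact localization_indepS (I J : {set T}) : I \subset J ->
  J \in localization_indep -> I \in localization_indep.
Proof.
rewrite !inE => sIJ /andP[iJ sJF].
by rewrite (indepS sIJ iJ) (subset_trans sIJ).
Qed.

Fact localization_indep_aug (I J : {set T}) :
  I \in localization_indep -> J \in localization_indep -> (#|I| < #|J|)%N ->
  exists2 e, e \in J :\: I & e |: I \in localization_indep.
Proof.
rewrite !inE => /andP[iI sIF] /andP[iJ sJF] /(indep_aug iI iJ)[e Je iIe].
exists e => //; rewrite inE iIe subUset sub1set sIF andbT /=.
by apply: (subsetP sJF); case/setDP: Je.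
Qed.

Definition localization : matroid T :=
  Matroid localization_indep_ground localization_indep0
          localization_indepS localization_indep_aug.

End Localization.

Section Contraction.
Variables (T : finType) (M : matroid T) (F : {set T}).

Definition contraction_indep : {set {set T}} :=
  [set I : {set T} | (I \subset ground M :\: F)
                     && (rk M (I :|: F) == #|I| + rk M F)%N].

Fact contraction_indep_ground I :
  I \in contraction_indep -> I \subset ground M :\: F.
Proof. by rewrite inE => /andP[]. Qed.

Fact contraction_indep0 : set0 \in contraction_indep.
Proof. by rewrite inE sub0set set0U cards0 eqxx. Qed.

Fact contraction_indepS (I J : {set T}) : I \subset J ->
  J \in contraction_indep -> I \in contraction_indep.
Proof.
rewrite !inE => sIJ /andP[sJ /eqP rJ]; rewrite (subset_trans sIJ sJ) /=.
rewrite eqn_leq rkU_card /=.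
have := rkU_card M (J :\: I) (I :|: F).
rewrite setUA (_ : J :\: I :|: I = J); last first.
  by rewrite setUC -[RHS](setID J I) (setIidPr sIJ).
by rewrite rJ -(cardsID I J) (setIidPr sIJ) addnAC addnC leq_add2l.
Qed.

Fact contraction_indep_aug (I J : {set T}) :
  I \in contraction_indep -> J \in contraction_indep -> (#|I| < #|J|)%N ->
  exists2 e, e \in J :\: I & e |: I \in contraction_indep.
Proof.
rewrite !inE => /andP[sI /eqP rI] /andP[sJ /eqP rJ] ltIJ.
have [B [iB sB cB]] := rk_basis M F.
have basisI (K : {set T}) : K \subset ground M :\: F ->
    rk M (K :|: F) = (#|K| + rk M F)%N -> K :|: B \in indep M.
  move=> sK rK.
  have [X [iX sBX sX cX]] := rk_ext iB (subset_trans sB (subsetUr K F)).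
  have XF : (#|X :&: F| <= rk M F)%N.
    by apply: leq_rk (subsetIr _ _); apply: indepS iX; apply: subsetIl.
  have XK : X :\: F \subset K.
    apply/subsetP => e; rewrite inE => /andP[nFe Xe].
    by have := subsetP sX e Xe; rewrite inE (negPf nFe) orbF.
  have BX : B \subset X :&: F by rewrite subsetI sBX.
  have := cardsID F X; rewrite cX rK => eqc.
  have eB : X :&: F = B.
    by apply/esym/eqP; rewrite eqEcard BX cB.
  have eK : X :\: F = K.
    apply/eqP; rewrite eqEcard XK /=.
    by move: eqc; rewrite eB cB addnC => /addIn ->.
  by rewrite -eK -eB setUC setID.
have disj (K : {set T}) : K \subset ground M :\: F -> #|K :|: B| = (#|K| + #|B|)%N.
  move=> sK; rewrite cardsU (_ : K :&: B = set0) ?cards0 ?subn0 //.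
  apply/eqP; rewrite -subset0; apply/subsetP => e; rewrite !inE => /andP[Ke Be].
  by have := subsetP sK e Ke; rewrite inE (subsetP sB).
have [|e] := indep_aug (basisI I sI rI) (basisI J sJ rJ).
  by rewrite !disj // ltn_add2r.
rewrite !inE negb_or => /andP[/andP[nIe nBe]]; rewrite (negPf nBe) orbF => Je iIe.
exists e; first by rewrite inE nIe.
have sIe : e |: I \subset ground M :\: F.
  by rewrite subUset sub1set sI (subsetP sJ).
rewrite inE sIe /= eqn_leq rkU_card /=.
rewrite -cB -disj // -setUA; apply: leq_rk => //.
by rewrite setUA; apply: setUS.
Qed.

Definition contraction : matroid T :=
  Matroid contraction_indep_ground contraction_indep0
          contraction_indepS contraction_indep_aug.

End Contraction.

Section Minors.
Variables (T : finType) (M : matroid T).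
Implicit Types A F G : {set T}.

Lemma rk_localization F A : A \subset F -> rk (localization M F) A = rk M A.
Proof.
move=> sA; apply: eq_bigl => I; rewrite /= inE -andbA; congr andb.
by apply: andb_idl => /subset_trans; apply.
Qed.

Lemma rk_contraction F A : A \subset ground M :\: F ->
  (rk (contraction M F) A + rk M F = rk M (A :|: F))%N.
Proof.
move=> sA; apply/eqP; rewrite eqn_leq; apply/andP; split.
  have [I [iI sI <-]] := rk_basis (contraction M F) A.
  move: iI; rewrite /= inE => /andP[_ /eqP<-].
  by apply: rkS; apply: setSU.
have [B [iB sB cB]] := rk_basis M F.
have [X [iX sBX sX cX]] := rk_ext iB (subset_trans sB (subsetUr A F)).
have XF : (#|X :&: F| <= rk M F)%N.
  by apply: leq_rk (subsetIr _ _); apply: indepS iX; apply: subsetIl.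
have XK : X :\: F \subset A.
  apply/subsetP => e; rewrite inE => /andP[nFe Xe].
  by have := subsetP sX e Xe; rewrite inE (negPf nFe) orbF.
rewrite -cX -(cardsID F X) addnC leq_add // leq_rk //= inE.
rewrite (subset_trans XK sA) eqn_leq rkU_card /=.
have /eqP eXF : X :&: F == B by rewrite eq_sym eqEcard subsetI sBX sB cB.
rewrite -cB -[B in X in (X <= _)%N]eXF addnC cardsID; apply: leq_rk => //.
by rewrite -{1}(setID X F) setUC setUS // subsetIr.
Qed.

Lemma flats_localization F : F \in flats M ->
  flats (localization M F) = [set G in flats M | G \subset F].
Proof.
move=> fF; have sF := flat_ground fF; apply/setP => G; rewrite [RHS]inE.
have gE : ground (localization M F) = F := setIidPr sF.
apply/flatP/andP; rewrite gE; [move=> [sG fG] | move=> [fG sG]].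
  split=> //; apply/flatP; split=> [|e Ee nGe]; first exact: subset_trans sF.
  have [Fe|nFe] := boolP (e \in F).
    have := fG e Fe nGe.
    by rewrite !rk_localization // subUset sub1set Fe.
  rewrite ltnNge; apply: contraNN nFe => le1.
  have: e |: G \subset F.
    apply: (flat_rk_le fF); first by rewrite subUset sub1set Ee (subset_trans sG).
    apply: leq_trans le1 _; apply: rkS.
    by rewrite subsetI subsetUr.
  by rewrite subUset sub1set => /andP[].
split=> // e Fe nGe; rewrite !rk_localization // ?subUset ?sub1set ?Fe //.
by case/flatP: fG => _; apply=> //; apply: (subsetP sF).
Qed.

Lemma flats_contraction F : F \in flats M ->
  flats (contraction M F) = [set G :\: F | G in flats M & F \subset G].
Proof.
move=> fF; have sF := flat_ground fF; apply/setP => G.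
apply/idP/imsetP => [/flatP[/= sG fG]|[H]].
  have eG : G = (G :|: F) :\: F.
    rewrite setDUl setDv setU0; apply/esym/setDidPl.
    by rewrite disjoint_sym disjoints_subset; apply: subset_trans (_ : F \subset _) _;
       rewrite // subsetC; apply: subset_trans sG _; rewrite setDE subsetIr.
  exists (G :|: F) => //; rewrite inE subsetUr andbT; apply/flatP; split.
    by rewrite subUset sF (subset_trans sG) // subsetDl.
  move=> e Ee; rewrite inE negb_or => /andP[nGe nFe].
  have := fG e; rewrite inE nFe Ee => /(_ isT nGe).
  rewrite -(ltn_add2r (rk M F)) !rk_contraction // ?setUA //.
  by rewrite subUset sub1set sG inE nFe Ee.
rewrite inE => /andP[fH sFH] ->; apply/flatP => /=.
have sH : H :\: F \subset ground M :\: F by apply: setSD; apply: flat_ground.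
split=> // e; rewrite inE => /andP[nFe Ee]; rewrite inE nFe /= => nHe.
rewrite -(ltn_add2r (rk M F)) !rk_contraction // -?setUA.
  rewrite (_ : H :\: F :|: F = H); last first.
    by rewrite -{2}(setID H F) (setIidPr sFH) setUC.
  by case/flatP: fH => _; apply.
by rewrite subUset sub1set sH inE nFe Ee.
Qed.

End Minors.

(* [mobius L F G] is the Moebius function of the family [L], ordered by
   inclusion, on the interval from [F] to [G]; the recursion is on an upper
   bound of the size of [G]. *)
Section Mobius.
Variables (T : finType).
Implicit Types (L : {set {set T}}) (A F G H : {set T}).

Fixpoint mobius_rec L F n G : int :=
  if n is m.+1 then
    if G == F then 1
    else - \sum_(H in L | (F \subset H) && (H \proper G)) mobius_rec L F m H
  else 0.

Definition mobius L F G : int := mobius_rec L F #|G|.+1 G.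

Lemma mobius_rec_fuel L F n G : (#|G| < n)%N ->
  mobius_rec L F n G = mobius L F G.
Proof.
suff fuel m : (#|G| < n)%N -> (#|G| < m)%N ->
    mobius_rec L F n G = mobius_rec L F m G by move=> ltGn; apply: fuel.
elim: n m G => // n IHn [|m] G //= leGn leGm.
case: ifP => // _; congr (- _); apply: eq_bigr => H /andP[_ /andP[_ /proper_card lt]].
by apply: IHn; apply: leq_trans lt _.
Qed.

Lemma mobiusE L F G : mobius L F G =
  if G == F then 1
  else - \sum_(H in L | (F \subset H) && (H \proper G)) mobius L F H.
Proof.
rewrite {1}/mobius /=; case: ifP => // _; congr (- _).
apply: eq_bigr => H /andP[_ /andP[_ /proper_card lt]].
by rewrite mobius_rec_fuel.
Qed.

Lemma mobius_suml L F G : F \in L -> G \in L ->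
  \sum_(H in L | (F \subset H) && (H \subset G)) mobius L F H = (F == G)%:R.
Proof.
move=> LF LG; case: (eqVneq F G) => [<-|nFG].
  rewrite (bigD1 F) ?LF ?subxx //= big1 ?addr0 => [|H]; first by rewrite mobiusE eqxx.
  by rewrite -eqEsubset eq_sym => /andP[/andP[_ ->]].
have [sFG|nsFG] := boolP (F \subset G); last first.
  rewrite big1 // => H /andP[_ /andP[sFH sHG]].
  by rewrite (subset_trans sFH sHG) in nsFG.
rewrite (bigD1 G) ?LG ?subxx ?sFG //= mobiusE eq_sym (negPf nFG).
apply/eqP; rewrite addrC subr_eq0; apply/eqP; apply: eq_bigl => H.
by rewrite properEneq -!andbA [(H \subset G) && _]andbC.
Qed.

Lemma mobius_sumr L F G : F \in L -> G \in L ->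
  \sum_(H in L | (F \subset H) && (H \subset G)) mobius L H G = (F == G)%:R.
Proof.
move=> LF LG.
pose e i := @enum_val _ (mem L) i.
pose Mu := \matrix_(i < #|L|, j < #|L|)
  ((e i \subset e j)%:R * mobius L (e i) (e j)) : 'M[int]_#|L|.
pose Z := \matrix_(i < #|L|, j < #|L|) (e i \subset e j)%:R : 'M[int]_#|L|.
have MuZ : Mu *m Z = 1%:M.
  apply/matrixP => i j; rewrite !mxE.
  rewrite (_ : (i == j) = (e i == e j)); last by rewrite (inj_eq enum_val_inj).
  rewrite -(mobius_suml (enum_valP i) (enum_valP j)) big_mkcondr /=.
  rewrite [RHS]big_enum_val /=; apply: eq_bigr => k _; rewrite !mxE -/(e k).
  by case: (_ \subset _); case: (_ \subset _); rewrite ?mulr0 ?mul0r ?mulr1 ?mul1r.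
have /matrixP/(_ (enum_rank_in LF F) (enum_rank_in LF G)) := mulmx1C MuZ.
rewrite !mxE.
rewrite (_ : (_ == _) = (F == G)); last first.
  by rewrite -(inj_eq enum_val_inj) !enum_rankK_in.
move=> <-; rewrite big_mkcondr [LHS]big_enum_val /=; apply: eq_bigr => k _.
rewrite !mxE /e !enum_rankK_in //.
by case: (_ \subset _); case: (_ \subset _); rewrite ?mulr0 ?mul0r ?mulr1 ?mul1r.
Qed.

Lemma mobius_local L L' F G :
  (forall H, H \proper G -> (H \in L) = (H \in L')) ->
  mobius L F G = mobius L' F G.
Proof.
have [n] := ubnP #|G|; elim: n G => // n IHn G leGn eqL.
rewrite !mobiusE; case: ifP => // _; congr (- _).
have eqP H : (H \in L) && ((F \subset H) && (H \proper G))
           = (H \in L') && ((F \subset H) && (H \proper G)).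
  by case pH: (H \proper G); rewrite ?andbF // eqL.
rewrite (eq_bigl _ _ eqP); apply: eq_bigr => H /andP[_ /andP[_ pH]].
apply: IHn; first by apply: leq_trans (proper_card pH) _.
by move=> K pK; apply: eqL; apply: proper_trans pH.
Qed.

End Mobius.

Section ContractionBig.
Variables (T : finType) (M : matroid T).
Implicit Types A F G H : {set T}.

Lemma setDK_sub F G : F \subset G -> G :\: F :|: F = G.
Proof. by move=> sFG; rewrite -[RHS](setID G F) (setIidPr sFG) setUC. Qed.

Lemma sub_setD F G H : F \subset G -> F \subset H ->
  (G :\: F \subset H :\: F) = (G \subset H).
Proof.
move=> sG sH; apply/idP/idP => [sD|]; last exact: setSD.
by rewrite -(setDK_sub sG) -(setDK_sub sH) setSU.
Qed.

Lemma eq_setD F G H : F \subset G -> F \subset H ->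
  (G :\: F == H :\: F) = (G == H).
Proof. by move=> sG sH; rewrite !eqEsubset !sub_setD. Qed.

Lemma proper_setD F G H : F \subset G -> F \subset H ->
  (G :\: F \proper H :\: F) = (G \proper H).
Proof. by move=> sG sH; rewrite !properE !sub_setD. Qed.

Lemma big_flats_contraction (R : nmodType) F (f : {set T} -> R) : F \in flats M ->
  \sum_(G in flats (contraction M F)) f G
    = \sum_(G in flats M | F \subset G) f (G :\: F).
Proof.
move=> fF; rewrite flats_contraction // big_imset /=; last first.
  move=> G H; rewrite !inE => /andP[_ sG] /andP[_ sH] /eqP.
  by rewrite eq_setD // => /eqP.
by apply: eq_bigl => G; rewrite inE.
Qed.

Lemma big_flats_contraction_cond (R : nmodType) F (f : {set T} -> R)
    (Q : pred {set T}) : F \in flats M ->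
  \sum_(G in flats (contraction M F) | Q G) f G
    = \sum_(G in flats M | (F \subset G) && Q (G :\: F)) f (G :\: F).
Proof.
move=> fF; rewrite big_mkcondr big_flats_contraction // -big_mkcondr.
by apply: eq_bigl => G; rewrite andbA.
Qed.

Lemma mobius_contraction F A G : F \in flats M -> F \subset A -> F \subset G ->
  mobius (flats (contraction M F)) (A :\: F) (G :\: F) = mobius (flats M) A G.
Proof.
move=> fF sA; have [n] := ubnP #|G|; elim: n G => // n IHn G leGn sG.
rewrite !mobiusE eq_setD //; case: ifP => // _; congr (- _).
rewrite big_flats_contraction_cond //.
rewrite (eq_bigl (fun H => (H \in flats M) && ((A \subset H) && (H \proper G)))); last first.
  move=> H; case sH: (F \subset H); first by rewrite sub_setD // proper_setD.
  rewrite andbF; case sAH : (A \subset H); rewrite ?andbF //.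
  by rewrite (subset_trans sA sAH) in sH.
apply: eq_bigr => H /andP[_ /andP[sAH pH]].
apply: IHn; last exact: subset_trans sAH.
by apply: leq_trans (proper_card pH) _.
Qed.

Lemma rk_con F G : G \in flats M -> F \subset G ->
  (rk (contraction M F) (G :\: F) = rk M G - rk M F)%N.
Proof.
move=> fG sFG; have := @rk_contraction _ M F (G :\: F).
rewrite setDK_sub // setSD ?flat_ground // => /(_ isT) <-.
by rewrite addnK.
Qed.

Lemma rank_con F : F \subset ground M -> (rank (contraction M F) = rank M - rk M F)%N.
Proof. by move=> sF; apply: rk_con; rewrite ?groundF. Qed.

Lemma rank_loc F : F \in flats M -> rank (localization M F) = rk M F.
Proof. by move=> /flat_ground sF; rewrite /rank /= (setIidPr sF) rk_localization. Qed.

Lemma cl0_loc F : F \in flats M -> cl (localization M F) set0 = cl M set0.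
Proof.
move=> fF; apply/esym/flat_rk0.
  by rewrite flats_localization // inE cl0_flat cl0_sub.
by rewrite rk_localization ?cl0_sub // rk_cl0.
Qed.

Lemma cl0_con F : F \in flats M -> cl (contraction M F) set0 = F :\: F.
Proof.
move=> fF; apply/esym/flat_rk0; last by rewrite rk_con // subnn.
by rewrite flats_contraction //; apply: imset_f; rewrite inE fF subxx.
Qed.

Lemma con_con F G : F \in flats M -> G \in flats M -> F \subset G ->
  contraction (contraction M F) (G :\: F) = contraction M G.
Proof.
move=> fF fG sFG.
have eqg : (ground M :\: F) :\: (G :\: F) = ground M :\: G.
  by rewrite setDDl setUC setDK_sub.
apply: matroid_eq => //=; apply/setP => I; rewrite !inE /= eqg.
case sI : (I \subset _) => //=.
rewrite -(eqn_add2r (rk M F)) -addnA !rk_contraction.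
- by rewrite -setUA setDK_sub.
- by rewrite setSD // flat_ground.
- rewrite subUset setSD ?flat_ground // andbT.
  by apply: subset_trans sI _; apply: setDS.
Qed.

End ContractionBig.

(* [cl M set0] is the least flat. With the Moebius function of the lattice of
   flats, loops do not make the polynomial vanish, so that the defining recursion
   of Kazhdan-Lusztig polynomials is consistent for matroids with loops. *)
Definition charpoly (T : finType) (M : matroid T) : {poly int} :=
  \sum_(F in flats M)
    mobius (flats M) (cl M set0) F *: 'X^(rank M - rk M F).

(* [reverse r p] is t^r p(t^-1) whenever [size p <= r.+1], see
   [horner_reverse]. *)
Definition reverse (r : nat) (p : {poly int}) : {poly int} :=
  \poly_(i < r.+1) p`_(r - i).

Definition KL_assignment (P : forall T : finType, matroid T -> {poly int}) :=
  forall (T : finType) (M : matroid T),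
  [/\ rank M = 0%N -> P T M = 1,
      (0 < rank M)%N -> (2 * (size (P T M)).-1 < rank M)%N
    & reverse (rank M) (P T M)
      = \sum_(F in flats M) charpoly (localization M F) * P T (contraction M F)].

Section Reverse.
Implicit Types p q : {poly int}.

Fact reverse_is_linear r : linear (reverse r).
Proof.
move=> a p q; apply/polyP => i; rewrite !(coef_poly, coefE).
by case: ifP; rewrite ?coefE // mulr0 addr0.
Qed.
HB.instance Definition _ r :=
  GRing.isLinear.Build int {poly int} {poly int} _ (reverse r) (reverse_is_linear r).

Lemma reverseXn r k : (k <= r)%N -> reverse r 'X^(r - k) = 'X^k.
Proof.
move=> kr; apply/polyP => i; rewrite !coefE; case: ltnP => ir.
  by rewrite eqn_sub2lE.
by case: eqP => // eik; rewrite eik ltnNge kr in ir.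
Qed.

Lemma reverseK r p : (size p <= r.+1)%N -> reverse r (reverse r p) = p.
Proof.
move=> sp; apply/polyP => i; rewrite !coef_poly; case: ltnP => ir.
  by rewrite ltnS leq_subr subKn.
by rewrite nth_default // (leq_trans sp).
Qed.

Lemma size_reverse r p : (size (reverse r p) <= r.+1)%N.
Proof. exact: size_poly. Qed.

Lemma horner_reverse (R : fieldType) r p (x : R) : (size p <= r.+1)%N -> x != 0 ->
  (map_poly intr (reverse r p)).[x] = x ^+ r * (map_poly intr p).[x^-1].
Proof.
move=> sp nx.
have hp q : (size q <= r.+1)%N -> forall y : R,
    (map_poly intr q).[y] = \sum_(i < r.+1) (q`_i)%:~R * y ^+ i.
  move=> sq y; rewrite (@horner_coef_wide _ r.+1).
    by apply: eq_bigr => i _; rewrite coef_map.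
  by apply: leq_trans (size_poly _ _) _.
rewrite !hp ?size_reverse // mulr_sumr (reindex_inj rev_ord_inj) /=.
apply: eq_bigr => i _; have le_ir : (i <= r)%N by rewrite -ltnS.
rewrite subSS coef_poly ltnS leq_subr subKn // mulrCA; congr (_ * _).
by rewrite -[in x ^+ r](subnK le_ir) exprD exprVn -mulrA mulfV ?mulr1 ?expf_neq0.
Qed.

Lemma reverseM r s p q : (size p <= r.+1)%N -> (size q <= s.+1)%N ->
  reverse (r + s) (p * q) = reverse r p * reverse s q.
Proof.
move=> sp sq.
have dec n (f : {poly int}) : (size f <= n.+1)%N ->
    f = \sum_(i < n.+1) f`_i *: 'X^i.
  move=> sf; rewrite -poly_def; apply/polyP => i; rewrite coef_poly.
  by case: ltnP => // ni; rewrite nth_default // (leq_trans sf).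
have revX n i : (i <= n)%N -> reverse n 'X^i = 'X^(n - i).
  by move=> le_in; rewrite -{1}(subKn le_in) reverseXn // leq_subr.
rewrite (dec r p sp) (dec s q sq) mulr_suml !linear_sum mulr_suml.
apply: eq_bigr => i _; rewrite !linearZ /= !mulr_sumr linear_sum.
apply: eq_bigr => j _; rewrite !linearZ /= -!scalerAl -!scalerAr !linearZ /=.
have hi : (i <= r)%N by rewrite -ltnS.
have hj : (j <= s)%N by rewrite -ltnS.
rewrite -exprD !revX ?leq_add // -exprD !scalerA [q`_j * _]mulrC.
by rewrite subnDA -addnBAC // addnBA.
Qed.

End Reverse.
Section CharpolyMinors.
Variables (T : finType) (M : matroid T).
Implicit Types A F G : {set T}.

Lemma charpoly_localization F : F \in flats M ->
  charpoly (localization M F) = \sum_(A in flats M | A \subset F)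
    mobius (flats M) (cl M set0) A *: 'X^(rk M F - rk M A).
Proof.
move=> fF; rewrite /charpoly rank_loc // cl0_loc // flats_localization //.
have memE A : (A \in [set G in flats M | G \subset F])
    = (A \in flats M) && (A \subset F) by rewrite inE.
rewrite (eq_bigl _ _ memE); apply: eq_bigr => A /andP[fA sAF].
rewrite rk_localization //; congr (_ *: _); apply: mobius_local => H pH.
by rewrite inE andb_idr // => _; apply: subset_trans (proper_sub pH) sAF.
Qed.

Lemma charpoly_rank0 : rank M = 0%N -> charpoly M = 1.
Proof.
move=> r0; rewrite /charpoly (big_pred1 (cl M set0)) => [|F].
  by rewrite mobiusE eqxx scale1r r0.
rewrite /= -[RHS]andTb; apply/idP/eqP => [fF|->]; last exact: cl0_flat.
apply: flat_rk0 => //; apply/eqP; rewrite -leqn0 -r0; apply: rkS.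
exact: flat_ground.
Qed.

Lemma size_sum_le (I : finType) (Q : pred I) (f : I -> {poly int}) n :
  (forall i, Q i -> (size (f i) <= n)%N) -> (size (\sum_(i | Q i) f i)%R <= n)%N.
Proof.
move=> h; elim/big_ind: _ => //; first by rewrite size_poly0.
by move=> p q hp hq; apply: leq_trans (size_polyD _ _) _; rewrite geq_max hp.
Qed.

Lemma size_charpoly : (size (charpoly M) <= (rank M).+1)%N.
Proof.
apply: size_sum_le => F _; apply: leq_trans (size_scale_leq _ _) _.
by rewrite size_polyXn ltnS leq_subr.
Qed.

End CharpolyMinors.

Section CharpolyKernel.
Variables (T : finType) (M : matroid T).
Implicit Types A F G : {set T}.

Lemma charpoly_con_loc F G : F \in flats M -> G \in flats M -> F \subset G ->
  charpoly (localization (contraction M F) (G :\: F)) =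
  \sum_(B in flats M | (F \subset B) && (B \subset G))
    mobius (flats M) F B *: 'X^(rk M G - rk M B).
Proof.
move=> fF fG sFG; rewrite charpoly_localization; last first.
  by rewrite flats_contraction //; apply: imset_f; rewrite inE fG.
rewrite big_flats_contraction_cond //.
rewrite (eq_bigl (fun B => (B \in flats M) && ((F \subset B) && (B \subset G)))); last first.
  by move=> B; case sB : (F \subset B); rewrite ?andbF // sub_setD.
apply: eq_bigr => B /andP[fB /andP[sFB sBG]].
rewrite cl0_con // mobius_contraction // !rk_con //.
by rewrite subnBA ?subnK ?rkS.
Qed.

Lemma charpoly_con0_loc G : G \in flats M ->
  charpoly (localization (contraction M (cl M set0)) (G :\: cl M set0)) =
  charpoly (localization M G).
Proof.
move=> fG; rewrite charpoly_con_loc ?cl0_flat ?cl0_sub //.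
rewrite charpoly_localization //; apply: eq_bigl => B.
by case fB : (B \in flats M) => //=; rewrite cl0_sub.
Qed.

Lemma charpoly_kernel G : G \in flats M ->
  \sum_(F in flats M | F \subset G) reverse (rk M F) (charpoly (localization M F))
     * charpoly (localization (contraction M F) (G :\: F))
  = (rk M G == 0%N)%:R.
Proof.
move=> fG; pose z := cl M set0; pose L := flats M.
pose mz A := mobius L z A *: 'X^(rk M A) : {poly int}.
transitivity (\sum_(F in L | F \subset G) \sum_(A in L | A \subset F)
    \sum_(B in L | (F \subset B) && (B \subset G))
      mobius L F B *: (mz A * 'X^(rk M G - rk M B))).
  apply: eq_bigr => F /andP[fF sFG].
  rewrite charpoly_localization // charpoly_con_loc // linear_sum mulr_suml.
  apply: eq_bigr => A /andP[fA sAF]; rewrite linearZ /= reverseXn ?rkS //.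
  by rewrite mulr_sumr; apply: eq_bigr => B _; rewrite -scalerAr.
transitivity (\sum_(A in L) \sum_(B in L | B \subset G)
    \sum_(F in L | (A \subset F) && (F \subset B))
       mobius L F B *: (mz A * 'X^(rk M G - rk M B))).
  rewrite (exchange_big_dep (fun A => A \in L)) /=; last first.
    by move=> F A _ /andP[].
  apply: eq_bigr => A fA.
  rewrite (exchange_big_dep (fun B => (B \in L) && (B \subset G))) /=; last first.
    by move=> F B _ /and3P[-> _ ->].
  apply: eq_bigr => B /andP[fB sBG]; apply: eq_bigl => F.
  rewrite fA fB sBG /= andbT.
  case fF : (F \in L) => //=; case sAF : (A \subset F); rewrite ?andbF //=.
  case sFB : (F \subset B); rewrite ?andbF ?andbT //=.
  exact: subset_trans sFB sBG.
transitivity (\sum_(A in L | A \subset G) mobius L z A *: ('X^(rk M G) : {poly int})).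
  rewrite [RHS]big_mkcondr /=; apply: eq_bigr => A fA.
  rewrite (eq_bigr (fun B => (A == B)%:R *: (mz A * 'X^(rk M G - rk M B)))); last first.
    by move=> B /andP[fB _]; rewrite -scaler_suml mobius_sumr.
  case: ifP => [sAG|nsAG]; last first.
    rewrite big1 // => B /andP[fB sBG]; case: eqP => [eAB|_]; last by rewrite scale0r.
    by rewrite eAB sBG in nsAG.
  rewrite (bigD1 A) ?fA //= eqxx scale1r big1 ?addr0; last first.
    by move=> B /andP[_ nBA]; rewrite eq_sym (negPf nBA) scale0r.
  by rewrite /mz -scalerAl -exprD subnKC // rkS.
rewrite -scaler_suml.
rewrite (eq_bigl (fun A => (A \in L) && ((z \subset A) && (A \subset G)))); last first.
  by move=> A; case fA : (A \in L) => //=; rewrite cl0_sub.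
rewrite mobius_suml ?cl0_flat //.
case: eqP => [<-|nzG]; first by rewrite scale1r rk_cl0.
rewrite scale0r; case: eqP => // rG0.
by case: nzG; rewrite (flat_rk0 fG rG0).
Qed.

End CharpolyKernel.

Section Existence.
Variable T : finType.
Implicit Types (M : matroid T) (F G : {set T}).

Fixpoint KL_rec n M : {poly int} :=
  if n is m.+1 then
    if rank M == 0%N then 1
    else - \poly_(i < uphalf (rank M))
      (\sum_(F in flats M | (0 < rk M F)%N)
         charpoly (localization M F) * KL_rec m (contraction M F))`_i
  else 0.

Definition KL_def M := KL_rec (rank M).+1 M.

Definition KL_sum M : {poly int} :=
  \sum_(F in flats M | (0 < rk M F)%N)
    charpoly (localization M F) * KL_def (contraction M F).

Lemma rank_con_lt M F : F \in flats M -> (0 < rk M F)%N ->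
  (rank (contraction M F) < rank M)%N.
Proof.
move=> fF r0; rewrite rank_con ?flat_ground // ltn_subrL r0.
by rewrite (leq_trans r0) // rkS // flat_ground.
Qed.

Lemma KL_rec_fuel n M : (rank M < n)%N -> KL_rec n M = KL_def M.
Proof.
rewrite /KL_def.
suff fuel m : (rank M < n)%N -> (rank M < m)%N -> KL_rec n M = KL_rec m M.
  by move=> lt; apply: fuel.
elim: n m M => // n IHn [|m] M //= ltn ltm; case: ifP => // _.
congr (- _); apply: eq_poly => i _; apply: (congr1 (fun p : {poly int} => p`_i)).
apply: eq_bigr => F /andP[fF rF]; congr (_ * _).
by apply: IHn; apply: leq_trans (rank_con_lt fF rF) _.
Qed.

Lemma KL_defE M : KL_def M =
  if rank M == 0%N then 1 else - \poly_(i < uphalf (rank M)) (KL_sum M)`_i.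
Proof.
rewrite {1}/KL_def /=; case: ifP => // _.
congr (- _); apply: eq_poly => i _; apply: (congr1 (fun p : {poly int} => p`_i)).
apply: eq_bigr => F /andP[fF rF]; congr (_ * _).
by apply: KL_rec_fuel; apply: rank_con_lt.
Qed.

Lemma size_KL_def M : (0 < rank M)%N -> (2 * (size (KL_def M)).-1 < rank M)%N.
Proof.
move=> r0; rewrite KL_defE (gtn_eqF r0) size_polyN.
have := size_poly (uphalf (rank M)) (fun i => (KL_sum M)`_i).
by case: size => [|s] //= h; rewrite mul2n -gtn_uphalf_double.
Qed.

Lemma size_KL_def_le M : (size (KL_def M) <= (rank M).+1)%N.
Proof.
case: (posnP (rank M)) => [r0|r0]; first by rewrite KL_defE r0 eqxx size_poly1.
have := size_KL_def r0; case: size => [|s] //= h.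
by rewrite ltnS ltnW // (leq_ltn_trans _ h) // leq_pmull.
Qed.

Lemma KL_sum_con0 M : KL_sum (contraction M (cl M set0)) = KL_sum M.
Proof.
have fz := cl0_flat M.
rewrite /KL_sum big_flats_contraction_cond //.
apply: eq_big => [G|G /andP[fG /andP[sG _]]].
  case fG: (G \in flats M) => //=.
  by rewrite cl0_sub //= rk_con ?cl0_sub // rk_cl0 subn0.
by rewrite charpoly_con0_loc // con_con.
Qed.

Lemma KL_def_con0 M : KL_def (contraction M (cl M set0)) = KL_def M.
Proof.
by rewrite !KL_defE KL_sum_con0 rank_con ?rk_cl0 ?subn0 // flat_ground // cl0_flat.
Qed.

Definition KL_identity M := reverse (rank M) (KL_def M) =
  \sum_(F in flats M) charpoly (localization M F) * KL_def (contraction M F).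

Lemma size_KL_sum M : (size (KL_sum M) <= (rank M).+1)%N.
Proof.
apply: size_sum_le => F /andP[fF rF].
apply: leq_trans (size_polyMleq _ _) _.
have h1 := size_charpoly (localization M F).
have h2 := size_KL_def_le (contraction M F).
have := leq_add h1 h2; rewrite rank_loc // rank_con ?flat_ground //.
rewrite addSn addnS subnKC ?rkS ?flat_ground //.
by case: (_ + _)%N.
Qed.

Lemma reverse_KL_sum M :
  (forall F, F \in flats M -> (0 < rk M F)%N -> KL_identity (contraction M F)) ->
  reverse (rank M) (KL_sum M) = - KL_sum M.
Proof.
move=> IH; pose L := flats M; pose z := cl M set0.
pose k F G := charpoly (localization (contraction M F) (G :\: F)).
pose c F := reverse (rk M F) (charpoly (localization M F)).
transitivity (\sum_(F in L | (0 < rk M F)%N) \sum_(G in L | F \subset G)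
   c F * k F G * KL_def (contraction M G)).
  rewrite linear_sum /=; apply: eq_bigr => F /andP[fF rF].
  have sF := flat_ground fF.
  rewrite -(subnKC (rkS M sF : (rk M F <= rank M)%N)) -rank_con // reverseM; last first.
  - exact: size_KL_def_le.
  - by rewrite -rank_loc // size_charpoly.
  rewrite (IH F fF rF) big_flats_contraction // mulr_sumr.
  by apply: eq_bigr => G /andP[fG sFG]; rewrite con_con // mulrA.
rewrite (exchange_big_dep (fun G => G \in L)) /=; last first.
  by move=> F G _ /andP[].
rewrite /KL_sum -sumrN [RHS]big_mkcondr /=; apply: eq_bigr => G fG.
rewrite -mulr_suml; case: (posnP (rk M G)) => rG.
  rewrite big_pred0 ?mul0r // => F; apply/negP => /and3P[/andP[fF rF] _ sFG].
  by have := rkS M sFG; rewrite rG leqNgt rF.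
rewrite -mulNr; congr (_ * _).
have := charpoly_kernel fG; rewrite (gtn_eqF rG) /=.
rewrite (bigD1 z) /=; last by rewrite cl0_flat cl0_sub.
rewrite rk_cl0 charpoly_rank0 ?rank_loc ?cl0_flat ?rk_cl0 //.
rewrite -[1]/('X^(0 - 0)) reverseXn // mul1r charpoly_con0_loc // => /eqP.
rewrite addrC addr_eq0 => /eqP <-; apply: eq_bigl => F.
rewrite fG /=; case fF : (F \in L) => //=.
case sF: (F \subset G); rewrite ?andbF ?andbT //=.
rewrite lt0n; congr (~~ _); apply/eqP/eqP => [|->]; last by rewrite rk_cl0.
exact: flat_rk0.
Qed.

Lemma KL_def_identity M : KL_identity M.
Proof.
have [n] := ubnP (rank M); elim: n M => // n IHn M leM.
have fz := cl0_flat M.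
rewrite /KL_identity (bigD1 (cl M set0)) //= charpoly_rank0 ?rank_loc ?rk_cl0 //.
rewrite mul1r KL_def_con0.
rewrite (eq_bigl (fun F => (F \in flats M) && (0 < rk M F)%N)) => [|F]; last first.
  case fF : (F \in flats M) => //=; rewrite lt0n; congr (~~ _).
  by apply/eqP/eqP => [->|/(flat_rk0 fF)]; rewrite ?rk_cl0.
rewrite -/(KL_sum M).
have rev_sum : reverse (rank M) (KL_sum M) = - KL_sum M.
  apply: reverse_KL_sum => F fF rF; apply: IHn.
  by apply: leq_trans (rank_con_lt fF rF) _.
case: (posnP (rank M)) => [r0|r0].
  rewrite /KL_sum big_pred0 ?addr0 => [|F].
    by rewrite KL_defE r0 eqxx -[1]/('X^(0 - 0)) reverseXn.
  apply/negP => /andP[fF]; rewrite ltnNge -r0 rkS //; exact: flat_ground.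
apply/polyP => i; rewrite coefD coef_poly; case: ltnP => ir; last first.
  rewrite !nth_default ?addr0 //.
    by apply: leq_trans ir; apply: size_KL_sum.
  by apply: leq_trans ir; apply: size_KL_def_le.
have := congr1 (fun p : {poly int} => p`_i) rev_sum; rewrite coef_poly ir coefN.
rewrite KL_defE (gtn_eqF r0) !coefN !coef_poly !gtn_uphalf_double => eqS.
rewrite ltnS in ir.
rewrite doubleB ltn_subLR ?leq_double // -[(rank M).*2]addnn ltn_add2r eqS.
case: (ltngtP i.*2 (rank M)) => [_|_|ri]; rewrite ?oppr0 ?opprK ?addNr ?add0r //.
have eri : (rank M - i = i)%N by rewrite -ri -addnn addnK.
apply/eqP; move: eqS; rewrite eri => /eqP.
by rewrite -addr_eq0 -mulr2n mulrn_eq0 /= eq_sym.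
Qed.

End Existence.

Theorem KL_exists : exists P, KL_assignment P.
Proof.
exists KL_def => T M; split; [by move=> r0; rewrite KL_defE r0 eqxx| |].
  exact: size_KL_def.
exact: KL_def_identity.
Qed.

Theorem KL_unique P Q : KL_assignment P -> KL_assignment Q ->
  forall (T : finType) (M : matroid T), P T M = Q T M.
Proof.
move=> aP aQ T M; have [n] := ubnP (rank M); elim: n M => // n IHn M leM.
have rev_con0 N : (rank N < n.+1)%N -> reverse (rank N) (P T N - Q T N)
    = P T (contraction N (cl N set0)) - Q T (contraction N (cl N set0)).
  move=> leN; have [_ _ eqP] := aP T N; have [_ _ eqQ] := aQ T N.
  rewrite linearB /= eqP eqQ -sumrB (bigD1 (cl N set0)) ?cl0_flat //=.
  rewrite charpoly_rank0 ?rank_loc ?cl0_flat ?rk_cl0 // !mul1r.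
  rewrite big1 ?addr0 // => F /andP[fF nF]; rewrite IHn ?subrr //.
  rewrite ltnS in leN; apply: leq_trans leN; apply: rank_con_lt => //.
  by rewrite lt0n; apply: contraNneq nF => /(flat_rk0 fF) ->.
case: (posnP (rank M)) => [r0|r0].
  by have [-> // _ _] := aP T M; have [-> // _ _] := aQ T M.
pose z := cl M set0; have fz : z \in flats M := cl0_flat M.
have rz : rank (contraction M z) = rank M.
  by rewrite rank_con ?rk_cl0 ?subn0 // flat_ground.
have szB N : (0 < rank N)%N -> (2 * (size (P T N - Q T N)%R).-1 < rank N)%N.
  move=> rN; have [_ /(_ rN) hP _] := aP T N; have [_ /(_ rN) hQ _] := aQ T N.
  have := size_polyD (P T N) (- Q T N); rewrite size_polyN.
  move: hP hQ; rewrite !mul2n -!gtn_uphalf_double.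
  case: (size (P T N)) (size (Q T N)) => [|a] [|b] ha hb; rewrite ?max0n ?maxn0.
  - by rewrite leqn0 => /eqP->.
  - by case: size => // c; rewrite ltnS => /leq_ltn_trans; apply.
  - by case: size => // c; rewrite ltnS => /leq_ltn_trans; apply.
  case: size => [|c]; first by move=> _; apply: leq_ltn_trans ha.
  rewrite maxnSS ltnS => /leq_ltn_trans; apply.
  by rewrite gtn_max ha hb.
have D0 : P T (contraction M z) - Q T (contraction M z) = 0.
  have := rev_con0 (contraction M z); rewrite cl0_con // con_con // rz leM => /(_ isT).
  have := szB (contraction M z); rewrite rz => /(_ r0).
  set D := _ - _ => szD revD; apply/polyP => i; rewrite coef0.
  have big j : (rank M <= j.*2)%N -> D`_j = 0.
    move=> lej; rewrite nth_default //; move: szD; rewrite mul2n -gtn_uphalf_double.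
    by case: size => // c /= hc; apply: leq_trans hc _; rewrite leq_uphalf_double.
  case: (leqP (rank M) i.*2) => [/big //|lti].
  rewrite -revD coef_poly; case: ifP => // _; apply: big.
  rewrite doubleB -addnn -addnBA ?leq_addr // ltnW //.
move/(_ M leM): rev_con0; rewrite D0 => /(congr1 (reverse (rank M))).
rewrite linear0 reverseK => [/eqP|]; first by rewrite subr_eq0 => /eqP.
have := szB M r0; case: size => //= c hc.
by rewrite ltnS ltnW // (leq_ltn_trans _ hc) // leq_pmull.
Qed.

(* The unique assignment, by [KL_exists] and [KL_unique]. *)
Definition KL_poly (T : finType) (M : matroid T) : {poly int} :=
  sval (cid KL_exists) T M.

Lemma KL_polyP : KL_assignment KL_poly.
Proof. exact: svalP (cid KL_exists). Qed.

Record sgraph (V : finType) := SGraph {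
  adj :> rel V;
  adj_sym : symmetric adj;
  adj_irr : irreflexive adj
}.

Section CycleMatroid.
Variable V : finType.
Implicit Types (I J S : {set {set V}}) (c p : seq V) (x y : V).

Definition edges (G : sgraph V) : {set {set V}} :=
  [set [set p.1; p.2] | p : V * V & G p.1 p.2].

Definition joins S : rel V := fun x y => [set x; y] \in S.

(* No cycle on at least three distinct vertices has all its edges in [S]; such
   a cycle has at most #|V| vertices, see [acyclicP]. *)
Definition acyclic S : bool :=
  [forall k : 'I_#|V|.+1, [forall c : k.-tuple V,
     uniq c ==> (2 < size c)%N ==> ~~ cycle (joins S) c]].

Lemma acyclicP S : reflect
  (forall c, uniq c -> (2 < size c)%N -> ~~ cycle (joins S) c) (acyclic S).
Proof.
apply: (iffP forallP) => [h c uc sc|h k].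
  have lec : (size c < #|V|.+1)%N by rewrite ltnS -(card_uniqP uc) max_card.
  by have /forallP/(_ (in_tuple c)) := h (Ordinal lec); rewrite uc sc.
by apply/forallP => c; apply/implyP => uc; apply/implyP; apply: h.
Qed.

Lemma joins_sym S : symmetric (joins S).
Proof. by move=> x y; rewrite /joins setUC. Qed.

Lemma joins_connect_sym S : connect_sym (joins S).
Proof. exact/sym_connect_sym/joins_sym. Qed.

Lemma eq_set2 x y a b : a \notin [set x; y] -> ([set a; b] == [set x; y]) = false.
Proof. by move=> na; apply: contraNF na => /eqP <-; rewrite set21. Qed.

Lemma joins_avoid S x y z p : z \notin [set x; y] ->
  all [predC [set x; y]] p -> path (joins S) z (rcons p x) ->
  path (joins (S :\ [set x; y])) z (rcons p x).
Proof.
elim: p z => [|w p IHp] z nz /= => [_|/andP[nw ap]] /andP[ez pz].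
  by rewrite andbT /joins in_setD1 eq_set2.
by rewrite IHp // andbT /joins in_setD1 eq_set2.
Qed.

Lemma cycle_connect S x y p : uniq [:: x, y & p] -> (0 < size p)%N ->
  cycle (joins S) [:: x, y & p] -> connect (joins (S :\ [set x; y])) y x.
Proof.
rewrite /= !inE => /and3P[/norP[nxy nxp] nyp up].
case: p nxp nyp up => // z p; rewrite /= !inE !negb_or.
move=> /andP[nxz nxp] /andP[nyz nyp] /andP[nzp up] _ /and3P[_ eyz pz].
apply/connectP; exists (rcons (z :: p) x); last by rewrite last_rcons.
have nz : z \notin [set x; y].
  by rewrite !inE negb_or eq_sym nxz eq_sym nyz.
rewrite /= joins_avoid // ?andbT.
  by rewrite /joins setUC in_setD1 eq_set2 // setUC.
apply/allP => w pw; rewrite !inE negb_or; apply/andP.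
by split; apply: contraTneq pw => ->.
Qed.

Lemma acyclic_bridge S x y : x != y -> acyclic S -> [set x; y] \in S ->
  ~~ connect (joins (S :\ [set x; y])) x y.
Proof.
move=> nxy /acyclicP aS Sxy; apply/negP => /connectP[p pth lasty].
case/shortenP: pth lasty => q pthq uq _ lasty.
have sub z p' : path (joins (S :\ [set x; y])) z p' -> path (joins S) z p'.
  by apply: sub_path => a b; rewrite /joins inE => /andP[].
case: q pthq uq lasty => [|z q] pthq uq lasty; first by rewrite lasty eqxx in nxy.
case: q pthq uq lasty => [|w q] pthq uq lasty.
  by move: pthq; rewrite /= andbT -[z]lasty /joins !inE eqxx.
have := aS _ uq isT; apply/negP; rewrite negbK /cycle rcons_path sub //=.
by rewrite /= in lasty; rewrite -lasty joins_sym.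
Qed.

Lemma acyclic_add S x y : acyclic S -> ~~ connect (joins S) x y ->
  acyclic ([set x; y] |: S).
Proof.
move=> /acyclicP aS nc; apply/acyclicP => c uc sc; apply/negP => cyc.
have := aS c uc sc; apply/negP; rewrite negbK; apply: cycle_from_next => // a ca.
have := next_cycle cyc ca; case/rot_to: (ca) => i q eqc.
have := uc; have := sc; have := cyc.
rewrite -(rot_cycle i) -(size_rot i) -(rot_uniq i) -(next_rot i uc) eqc.
case: q {eqc} => // b q cycq sq uq; rewrite /= eqxx /joins in_setU1 => /orP[/eqP eab|//].
have := cycle_connect uq sq cycq; rewrite eab => /(connect_sub _) cab.
have {cab} : connect (joins S) b a.
  apply: cab => u v; rewrite /joins in_setD1 in_setU1 => /andP[nuv /orP[uv|uv]].
    by rewrite uv in nuv.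
  exact: connect1.
have nab : a != b by case/andP: uq; rewrite inE negb_or => /andP[].
have : a \in [set x; y] by rewrite -eab set21.
have : b \in [set x; y] by rewrite -eab set22.
rewrite !inE => /orP[]/eqP eb /orP[]/eqP ea; move: nc nab; rewrite ea eb ?eqxx //.
  by move=> /negPf->.
by rewrite joins_connect_sym => /negPf->.
Qed.

Variable G : sgraph V.

Lemma edgesP (e : {set V}) :
  reflect (exists x y, [/\ G x y, x != y & e = [set x; y]]) (e \in edges G).
Proof.
apply: (iffP imsetP) => [[[x y] /= Gxy ->]|[x [y [Gxy _ ->]]]].
  rewrite inE /= in Gxy; exists x, y; split=> //.
  by apply: contraTneq Gxy => ->; rewrite adj_irr.
by exists (x, y); rewrite ?inE.
Qed.

(* Steinitz exchange, for edge sets spanning the same vertex components *)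
Lemma leq_acyclic I J : I \subset edges G -> J \subset edges G -> acyclic J ->
  (forall x y, [set x; y] \in J -> connect (joins I) x y) -> (#|J| <= #|I|)%N.
Proof.
move=> sI; have [n] := ubnP #|J :\: I|; elim: n J => // n IHn J leJ sJ aJ spJ.
have [|/subsetPn[e Je nIe]] := boolP (J \subset I); first exact: subset_leq_card.
have /edgesP[x [y [_ nxy ee]]] := subsetP sJ e Je; rewrite ee in Je nIe.
have nc := acyclic_bridge nxy aJ Je.
set J0 := J :\ [set x; y] in nc.
have /subsetPn[f If] : ~~ (I \subset [set f in I |
    [forall u, forall v, (f == [set u; v]) ==> connect (joins J0) u v]]).
  apply: contraNN nc => /subsetP sub; have := spJ x y Je.
  apply: connect_sub => u v Iuv; have := sub _ Iuv; rewrite inE.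
  by case/andP=> _ /forallP/(_ u)/forallP/(_ v); rewrite eqxx.
rewrite inE If /= negb_forall => /existsP[u]; rewrite negb_forall => /existsP[v].
rewrite negb_imply => /andP[/eqP ef nuv].
have nJf : f \notin J0 by apply: contraNN nuv => Jf; apply: connect1; rewrite /joins -ef.
have cJ : #|f |: J0| = #|J| by rewrite cardsU1 nJf [RHS](cardsD1 [set x; y]) Je.
rewrite -cJ; apply: IHn.
- apply: leq_trans (_ : #|J :\: I| <= n)%N; last by [].
  apply: proper_card; apply/properP; split.
    apply/subsetP => g; rewrite !inE => /andP[nIg /orP[/eqP eg|/andP[_ Jg]]].
      by rewrite eg If in nIg.
    by rewrite nIg.
  exists [set x; y]; rewrite ?inE ?Je ?nIe //= eqxx orbF.
  by apply: contraNN nIe => /eqP ->.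
- rewrite subUset sub1set (subsetP sI) //.
  by apply: subset_trans sJ; apply: subsetDl.
- rewrite ef; apply: acyclic_add nuv; apply/acyclicP => c uc sc.
  apply: contraNN ((acyclicP _ aJ) c uc sc); apply: sub_cycle => a b.
  by rewrite /joins inE => /andP[].
move=> a b; rewrite !inE => /orP[/eqP eab|/andP[_]]; last exact: spJ.
by apply: connect1; rewrite /joins eab.
Qed.

Definition cycle_indep : {set {set {set V}}} :=
  [set I : {set {set V}} | (I \subset edges G) && acyclic I].

Fact cycle_indep_ground I : I \in cycle_indep -> I \subset edges G.
Proof. by rewrite inE => /andP[]. Qed.

Fact cycle_indep0 : set0 \in cycle_indep.
Proof.
rewrite inE sub0set; apply/acyclicP => -[|a [|b c]] //= _ _.
by rewrite /joins inE.
Qed.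

Fact cycle_indepS I J : I \subset J -> J \in cycle_indep -> I \in cycle_indep.
Proof.
move=> sIJ; rewrite !inE => /andP[sJ /acyclicP aJ]; rewrite (subset_trans sIJ sJ).
apply/acyclicP => c uc sc; apply: contraNN (aJ c uc sc); apply: sub_cycle => a b.
exact: (subsetP sIJ).
Qed.

Fact cycle_indep_aug I J : I \in cycle_indep -> J \in cycle_indep -> (#|I| < #|J|)%N ->
  exists2 e, e \in J :\: I & e |: I \in cycle_indep.
Proof.
rewrite !inE => /andP[sI aI] /andP[sJ aJ] ltIJ.
have [/exists_inP[e Je ae]|] :=
    boolP [exists e in J :\: I, e |: I \in cycle_indep]; first by exists e.
rewrite negb_exists => /forallP none; move: ltIJ; rewrite ltnNge leq_acyclic //.
move=> x y Jxy; have [Ixy|nIxy] := boolP ([set x; y] \in I); first exact: connect1.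
have := none [set x; y]; rewrite !inE Jxy nIxy /= subUset sub1set sI.
rewrite (subsetP sJ) //=; apply: contraNT; exact: acyclic_add.
Qed.

Definition cycle_matroid : matroid {set V} :=
  Matroid cycle_indep_ground cycle_indep0 cycle_indepS cycle_indep_aug.

End CycleMatroid.

(* [inl false] and [inl true] are the two distinguished vertices. *)
Section Thagomizer.
Variable n : nat.

Definition thagomizer_rel : rel (bool + 'I_n) := fun x y =>
  match x, y with
  | inl a, inl b => a != b
  | inl _, inr _ | inr _, inl _ => true
  | inr _, inr _ => false
  end.

Fact thagomizer_rel_sym : symmetric thagomizer_rel.
Proof. by case=> [a|i] [b|j] //=; rewrite eq_sym. Qed.

Fact thagomizer_rel_irr : irreflexive thagomizer_rel.
Proof. by case=> [a|i] //=; rewrite eqxx. Qed.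

Definition thagomizer_graph : sgraph (bool + 'I_n)%type :=
  SGraph thagomizer_rel_sym thagomizer_rel_irr.

Definition thagomizer : matroid {set bool + 'I_n} :=
  cycle_matroid thagomizer_graph.

End Thagomizer.

(* A step [true] goes up and a step [false] goes down. *)
Definition dyck (w : seq bool) : bool :=
  (count_mem true w == count_mem false w) &&
  [forall i : 'I_(size w).+1,
     (count_mem false (take i w) <= count_mem true (take i w))%N].

(* The steps of [w] numbered [i], ..., [j - 1] form a maximal run of up steps. *)
Definition ascent (w : seq bool) (i j : nat) : bool :=
  [&& (i < j <= size w)%N,
      all id (take (j - i) (drop i w)),
      (i == 0%N) || ~~ nth false w i.-1
    & (j == size w) || ~~ nth false w j].

Definition long_ascents (w : seq bool) : nat :=
  #|[set ij : 'I_(size w).+1 * 'I_(size w).+1 |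
      ascent w ij.1 ij.2 && (2 <= ij.2 - ij.1)%N]|.

Record fps (R : Type) := FPS { fcoef :> nat -> R }.

HB.instance Definition _ (R : Type) := gen_eqMixin (fps R).
HB.instance Definition _ (R : Type) := gen_choiceMixin (fps R).

Lemma fpsP (R : Type) (f g : fps R) : f =1 g -> f = g.
Proof. by case: f g => [f] [g] /= fg; congr FPS; apply: funext. Qed.

Section FpsRing.
Variable R : comNzRingType.
Implicit Types f g h : fps R.

Definition fps0 : fps R := FPS (fun=> 0).
Definition fps1 : fps R := FPS (fun n => (n == 0%N)%:R).
Definition fps_opp f : fps R := FPS (fun n => - f n).
Definition fps_add f g : fps R := FPS (fun n => f n + g n).
Definition fps_mul f g : fps R := FPS (fun n => \sum_(i < n.+1) f i * g (n - i)%N).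

Fact fps_addA : associative fps_add.
Proof. by move=> f g h; apply: fpsP => n /=; rewrite addrA. Qed.
Fact fps_addC : commutative fps_add.
Proof. by move=> f g; apply: fpsP => n /=; rewrite addrC. Qed.
Fact fps_add0 : left_id fps0 fps_add.
Proof. by move=> f; apply: fpsP => n /=; rewrite add0r. Qed.
Fact fps_addN : left_inverse fps0 fps_opp fps_add.
Proof. by move=> f; apply: fpsP => n /=; rewrite addNr. Qed.

HB.instance Definition _ :=
  GRing.isZmodule.Build (fps R) fps_addA fps_addC fps_add0 fps_addN.

Fact fps_mulC : commutative fps_mul.
Proof.
move=> f g; apply: fpsP => n /=; rewrite (reindex_inj rev_ord_inj) /=.
by apply: eq_bigr => i _; rewrite mulrC subSS subKn // -ltnS.
Qed.

(* Products of series agree with products of their truncations. *)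
Lemma fps_mul_trunc f g n m : (n <= m)%N ->
  fps_mul f g n = (\poly_(i < m.+1) f i * \poly_(i < m.+1) g i)`_n.
Proof.
move=> nm; rewrite coefM /=; apply: eq_bigr => i _.
have im : (i < m.+1)%N by apply: leq_trans (ltn_ord i) _.
by rewrite !coef_poly im ltnS (leq_trans (leq_subr _ _)).
Qed.

Fact fps_mulA : associative fps_mul.
Proof.
move=> f g h; apply: fpsP => n.
pose t (f : fps R) := \poly_(i < n.+1) f i.
transitivity ((t f * (t g * t h))`_n).
  rewrite coefM /=; apply: eq_bigr => i _; rewrite coef_poly ltn_ord; congr (_ * _).
  by rewrite -[LHS]/(fps_mul g h _) (fps_mul_trunc _ _ (leq_subr _ _)).
rewrite mulrA coefM /=; apply: eq_bigr => i _.
rewrite coef_poly ltnS leq_subr; congr (_ * _).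
by rewrite -[RHS]/(fps_mul f g _) (@fps_mul_trunc _ _ _ n) // -ltnS.
Qed.

Fact fps_mul1 : left_id fps1 fps_mul.
Proof.
move=> f; apply: fpsP => n /=; rewrite big_ord_recl /= mul1r subn0 big1 ?addr0 //.
by move=> i _; rewrite mul0r.
Qed.

Fact fps_mulDl : left_distributive fps_mul fps_add.
Proof.
move=> f g h; apply: fpsP => n /=; rewrite -big_split /=.
by apply: eq_bigr => i _; rewrite mulrDl.
Qed.

Fact fps1_neq0 : fps1 != 0.
Proof.
apply/eqP => /(congr1 (fun f : fps R => f 0%N)) /= /eqP.
by rewrite oner_eq0.
Qed.

HB.instance Definition _ := GRing.Zmodule_isComNzRing.Build (fps R)
  fps_mulA fps_mulC fps_mul1 fps_mulDl fps1_neq0.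

Definition fpsC (a : R) : fps R := FPS (fun n => if n == 0%N then a else 0).
Definition fpsX : fps R := FPS (fun n => (n == 1%N)%:R).

(* A coefficient determined by the previous ones determines a series. *)
Lemma fps_rec (step : (nat -> R) -> nat -> R) :
  (forall s s' n, (forall i, (i < n)%N -> s i = s' i) -> step s n = step s' n) ->
  exists f, forall n, f n = step f n.
Proof.
move=> stepE; pose s k := iter k step (fun=> 0).
have stable k n : (n < k)%N -> s k n = s n.+1 n.
  elim/ltn_ind: n k => n IHn [|k] // nk; rewrite /s !iterS; apply: stepE => i lt_in.
  by rewrite -/(s k) -/(s n) (IHn i lt_in k) ?(IHn i lt_in n) // (leq_trans lt_in).
exists (FPS (fun n => s n.+1 n)) => n; rewrite -[LHS]/(step (s n) n).
by apply: stepE => i lt_in; rewrite -/(s n) stable.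
Qed.

End FpsRing.

Section FpsUnit.
Variable R : comUnitRingType.
Implicit Types f g h : fps R.

Definition fps_unit : pred (fps R) := fun f => f 0%N \is a GRing.unit.

Lemma fps_inv_exists f : exists g, if fps_unit f then g * f = 1 else g = f.
Proof.
have [uf|_] := boolP (fps_unit f); last by exists f.
have [|g gE] := @fps_rec R (fun s n => (f 0%N)^-1 *
    ((n == 0%N)%:R - \sum_(i < n) s i * f (n - i)%N)).
  move=> s s' n ss'; congr (_ * (_ - _)); apply: eq_bigr => i _.
  by rewrite ss'.
exists g; apply: fpsP => n.
rewrite -[LHS]/(fps_mul g f n) /= big_ord_recr /= subnn.
by rewrite gE [_^-1 * _]mulrC divrK // addrC subrK.
Qed.

Definition fps_inv f : fps R := sval (cid (fps_inv_exists f)).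

Fact fps_inv_spec f : if fps_unit f then fps_inv f * f = 1 else fps_inv f = f.
Proof. exact: svalP (cid (fps_inv_exists f)). Qed.

Fact fps_mulV : {in fps_unit, left_inverse 1 fps_inv *%R}.
Proof.
move=> f; rewrite -topredE /= => uf.
by have := fps_inv_spec f; rewrite uf.
Qed.

Fact fps_unitP f g : g * f = 1 -> fps_unit f.
Proof.
move=> /(congr1 (fun h : fps R => h 0%N)); rewrite -[LHS]/(fps_mul g f 0) /=.
rewrite big_ord_recl big_ord0 addr0 => gf.
by apply/unitrP; exists (g 0%N); split=> //; rewrite mulrC.
Qed.

Fact fps_inv_out : {in [predC fps_unit], fps_inv =1 id}.
Proof.
move=> f; rewrite inE /= -topredE /= => /negPf uf.
by have := fps_inv_spec f; rewrite uf.
Qed.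

HB.instance Definition _ := GRing.ComNzRing_hasMulInverse.Build (fps R)
  fps_mulV fps_unitP fps_inv_out.

Lemma fps_sqrt_exists f :
  exists g, (2%:R : R) \is a GRing.unit -> f 0%N = 1 -> g 0%N = 1 /\ g ^+ 2 = f.
Proof.
have [|g gE] := @fps_rec R (fun s n => if n is m.+1 then
    2%:R^-1 * (f n - \sum_(i < m) s i.+1 * s (m - i)%N) else 1).
  move=> s s' [|n] // ss'; congr (_ * (_ - _)); apply: eq_bigr => i _.
  by rewrite (ss' i.+1) ?(ss' (n - i)%N) // ?ltnS ?leq_subr.
exists g => u2 f0; split; first by rewrite gE.
apply: fpsP => -[|n]; rewrite expr2 -[LHS]/(fps_mul g g _) /=.
  by rewrite big_ord_recl big_ord0 /= gE mulr1 addr0 f0.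
rewrite big_ord_recl big_ord_recr /= subn0 subnn [g 0%N]gE mul1r mulr1.
rewrite addrCA -mulr2n -mulr_natl [g n.+1]gE mulrA mulrV // mul1r addrC.
rewrite (eq_bigr (fun i : 'I_n => g i.+1 * g (n - i)%N)) ?subrK // => i _.
Qed.

(* The square root with constant coefficient 1, see [fps_sqrtP] and
   [fps_sqrt_unique]. *)
Definition fps_sqrt f : fps R := sval (cid (fps_sqrt_exists f)).

Lemma fps_sqrtP f : (2%:R : R) \is a GRing.unit -> f 0%N = 1 ->
  fps_sqrt f 0%N = 1 /\ fps_sqrt f ^+ 2 = f.
Proof. exact: svalP (cid (fps_sqrt_exists f)). Qed.

Lemma fps_sqrt_unique f g : (2%:R : R) \is a GRing.unit -> f 0%N = 1 ->
  g 0%N = 1 -> g ^+ 2 = f -> g = fps_sqrt f.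
Proof.
move=> u2 f0 g0 gf; have [s0 sf] := fps_sqrtP u2 f0.
have us : (g + fps_sqrt f) \is a GRing.unit.
  by rewrite -[_ \is a _]/((g 0%N + fps_sqrt f 0%N) \is a GRing.unit) g0 s0.
apply/eqP; rewrite -subr_eq0; apply/eqP; apply: (mulIr us).
by rewrite mul0r -subr_sqr gf sf subrr.
Qed.

End FpsUnit.

Definition fps_map (R S : Type) (h : R -> S) (f : fps R) : fps S :=
  FPS (fun n => h (f n)).

Definition KL_thagomizer (n : nat) : {poly int} := KL_poly (thagomizer n).

Definition KL_series : fps {poly int} :=
  FPS (fun m => if m is n.+1 then KL_thagomizer n else 0).

(* Main.v *)
From HB Require Import structures.
Require Import Defs.
From mathcomp Require Import all_boot all_order all_algebra.
From mathcomp Require Import ring zify.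
Import GRing.Theory.
Local Open Scope ring_scope.

Set Implicit Arguments.
Unset Strict Implicit.
Unset Printing Implicit Defensive.

(* The flats of M_n containing AB correspond to the subsets of {1, ..., n}, the others to
   the partial maps from {1, ..., n} to {A, B}. The contraction by a flat of the first kind
   is boolean up to parallel elements, with polynomial 1; the contraction by a partial map
   with support of size j is M_(n-j) up to parallel elements. The characteristic polynomials
   of the intervals are powers of t - 1 and (t - 1)(t - 2)^m, so the recursion defining the
   Kazhdan-Lusztig polynomials reduces to
     t^(n+1) P_n(1/t) = (t - 1)^(n+1) + sum_k C(n,k) (2(t - 1))^k P_(n-k)(t),
   that is, Phi(1/t, tu) = (t-1)u/(1 - (t-1)u) + Phi(t, u/(1 - 2(t-1)u)). If C is the series
   with C = 1 + u C^2 + (t - 1) u^2 C^2, then Phi = u C satisfies this identity because both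
   sides are roots, without constant term, of (1 - (t-1)u) X^2 - X + tu; and C enumerates
   Dyck words by long ascents. *)

(** * Formal power series *)

Section FpsCoef.
Variable R : comNzRingType.
Implicit Types f g h w : fps R.

Lemma fps_coef1 n : (1 : fps R) n = (n == 0%N)%:R. Proof. by []. Qed.
Lemma fps_coefD f g n : (f + g) n = f n + g n. Proof. by []. Qed.
Lemma fps_coefN f n : (- f) n = - f n. Proof. by []. Qed.
Lemma fps_coefM f g n : (f * g) n = \sum_(i < n.+1) f i * g (n - i)%N.
Proof. by []. Qed.

Lemma fps_coefXM0 f : (fpsX R * f) 0%N = 0.
Proof. by rewrite fps_coefM big_ord1 mul0r. Qed.

Lemma fps_coefXMS f n : (fpsX R * f) n.+1 = f n.
Proof.
rewrite fps_coefM big_ord_recl mul0r add0r big_ord_recl mul1r big1 ?addr0 ?subSS ?subn0 //.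
by move=> i _; rewrite mul0r.
Qed.

Definition fps_coefXM := (fps_coefXM0, fps_coefXMS).

Lemma fps_coefCM a f n : (fpsC a * f) n = a * f n.
Proof.
rewrite fps_coefM big_ord_recl /= subn0 big1 ?addr0 // => i _.
by rewrite mul0r.
Qed.

Fact fpsC_is_additive : zmod_morphism (@fpsC R).
Proof. by move=> a b; apply: fpsP => -[|n] //=; rewrite /= subr0. Qed.
Fact fpsC_is_monoid_morphism : monoid_morphism (@fpsC R).
Proof.
split=> [|a b]; apply: fpsP => -[|n] //; rewrite fps_coefCM //=.
by rewrite mulr0.
Qed.
HB.instance Definition _ := GRing.isZmodMorphism.Build R (fps R) (@fpsC R)
  fpsC_is_additive.
HB.instance Definition _ := GRing.isMonoidMorphism.Build R (fps R) (@fpsC R)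
  fpsC_is_monoid_morphism.

Lemma fps_coefX_small w k n : w 0%N = 0 -> (n < k)%N -> (w ^+ k) n = 0.
Proof.
move=> w0; elim: k n => // k IHk n nk.
rewrite exprS fps_coefM big_ord_recl w0 mul0r add0r big1 // => i _.
by rewrite IHk ?mulr0 // lift0; have := ltn_ord i; lia.
Qed.

(** Substitution of [w] into [f]. Cutting the sum at [m <= n] is harmless when [w] has no constant
    term, because [w ^+ m] then has no coefficient below [m]. *)
Definition fps_comp f w : fps R := FPS (fun n => \sum_(m < n.+1) f m * (w ^+ m) n).

Lemma fps_compE f w n N : w 0%N = 0 -> (n < N)%N ->
  fps_comp f w n = \sum_(m < N) f m * (w ^+ m) n.
Proof.
move=> w0 nN; rewrite /= (big_ord_widen N (fun m => f m * (w ^+ m) n)) //.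
rewrite big_mkcond /=; apply: eq_bigr => m _; case: ltnP => // nm.
by rewrite fps_coefX_small ?mulr0.
Qed.

Lemma fps_compD f g w : fps_comp (f + g) w = fps_comp f w + fps_comp g w.
Proof.
apply: fpsP => n; rewrite fps_coefD /= -big_split /=.
by apply: eq_bigr => m _; rewrite mulrDl.
Qed.

Lemma fps_compX w : w 0%N = 0 -> fps_comp (fpsX R) w = w.
Proof.
move=> w0; apply: fpsP => n; rewrite (@fps_compE _ _ _ n.+2) //.
rewrite big_ord_recl mul0r add0r big_ord_recl mul1r expr1 big1 ?addr0 // => i _.
by rewrite mul0r.
Qed.

Lemma fps_compC a w : fps_comp (fpsC a) w = fpsC a.
Proof.
apply: fpsP => n /=; rewrite big_ord_recl big1 ?addr0 => [|i _]; last by rewrite mul0r.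
rewrite [w ^+ _]expr0; case: n => [|n] /=; by rewrite (mulr1, mulr0).
Qed.

(** Both sides expand to the double sum of [f i * g j * (w ^+ (i + j)) n] over [i, j <= n]; the
    terms with [i + j > n] vanish. *)
Lemma fps_compM f g w : w 0%N = 0 -> fps_comp (f * g) w = fps_comp f w * fps_comp g w.
Proof.
move=> w0; apply: fpsP => n; rewrite fps_coefM.
transitivity (\sum_(i < n.+1) \sum_(j < n.+1) f i * g j * (w ^+ (i + j)) n).
  transitivity (\sum_(0 <= m < n.+1) \sum_(0 <= i < n.+1 | (i <= m)%N)
      f i * g (m - i)%N * (w ^+ m) n).
    rewrite big_mkord; apply: eq_bigr => m _; rewrite fps_coefM mulr_suml.
    rewrite (big_ord_widen n.+1 (fun i => f i * g (m - i)%N * (w ^+ m) n)) //.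
    by rewrite [RHS]big_mkord.
  rewrite (exchange_big_dep_nat xpredT) //= big_mkord; apply: eq_bigr => i _.
  rewrite -(big_mkord xpredT (fun j => f i * g j * (w ^+ (i + j)) n)).
  transitivity (\sum_(i <= m < n.+1) f i * g (m - i)%N * (w ^+ m) n).
    by rewrite [RHS](big_nat_widenl _ 0).
  have in1 : (i <= n.+1)%N by apply: ltnW.
  rewrite [RHS](@big_cat_nat _ _ _ (n.+1 - i)%N) ?leq_subr //=.
  rewrite [X in _ = _ + X]big_nat_cond [X in _ = _ + X]big1 ?addr0; last first.
    move=> j; rewrite andbT => /andP[nj _].
    by rewrite fps_coefX_small ?mulr0 //; lia.
  rewrite -{1}[nat_of_ord i]add0n big_addn.
  by apply: eq_bigr => j _; rewrite addnK addnC.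
transitivity (\sum_(i < n.+1) \sum_(j < n.+1) \sum_(a < n.+1)
   (f i * (w ^+ i) a) * (g j * (w ^+ j) (n - a)%N)).
  apply: eq_bigr => i _; apply: eq_bigr => j _.
  rewrite exprD fps_coefM mulr_sumr; apply: eq_bigr => a _.
  by rewrite -!mulrA; congr (_ * _); rewrite mulrCA.
under eq_bigr => i _ do rewrite exchange_big.
rewrite exchange_big; apply: eq_bigr => a _.
rewrite (@fps_compE _ _ _ n.+1) // (@fps_compE _ _ _ n.+1) ?ltnS ?leq_subr //.
rewrite mulr_suml; apply: eq_bigr => i _.
by rewrite mulr_sumr.
Qed.

(** Subtracting the equations gives f - g = a (f + g) (f - g), where a (f + g) has no constant term;
    hence every coefficient of f - g vanishes by induction. *)
Lemma fps_quadratic_unique a b f g : f 0%N = 0 -> g 0%N = 0 ->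
  a * f ^+ 2 - f + b = 0 -> a * g ^+ 2 - g + b = 0 -> f = g.
Proof.
move=> f0 g0 ef eg.
have solve h : a * h ^+ 2 - h + b = 0 -> h = a * h ^+ 2 + b.
  by move=> eh; apply/eqP; rewrite -subr_eq0 -oppr_eq0 -eh; apply/eqP; ring.
have e : f - g = (a * (f + g)) * (f - g).
  by rewrite {1}(solve f ef) {1}(solve g eg); ring.
have v0 : (a * (f + g)) 0%N = 0.
  by rewrite fps_coefM big_ord1 fps_coefD f0 g0 addr0 mulr0.
suff d0 n : (f - g) n = 0.
  by apply/eqP; rewrite -subr_eq0; apply/eqP; apply: fpsP.
elim/ltn_ind: n => n IHn; rewrite e fps_coefM big_ord_recl v0 mul0r add0r big1 // => i _.
by rewrite IHn ?mulr0 // lift0; have := ltn_ord i; lia.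
Qed.

End FpsCoef.

Section FpsMap.
Variables (R S : comNzRingType) (h : {rmorphism R -> S}).

Fact fps_map_is_zmod_morphism : zmod_morphism (fps_map h).
Proof. by move=> f g; apply: fpsP => n; rewrite /= rmorphB. Qed.

Fact fps_map_is_monoid_morphism : monoid_morphism (fps_map h).
Proof.
split=> [|f g]; apply: fpsP => n; first by rewrite /= rmorph_nat.
rewrite fps_coefM -[LHS]/(h _) fps_coefM rmorph_sum.
by apply: eq_bigr => i _; rewrite rmorphM.
Qed.

HB.instance Definition _ := GRing.isZmodMorphism.Build (fps R) (fps S) (fps_map h)
  fps_map_is_zmod_morphism.
HB.instance Definition _ := GRing.isMonoidMorphism.Build (fps R) (fps S) (fps_map h)
  fps_map_is_monoid_morphism.

Lemma fps_mapX : fps_map h (fpsX R) = fpsX S.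
Proof. by apply: fpsP => n; rewrite /= rmorph_nat. Qed.

Lemma fps_mapC a : fps_map h (fpsC a) = fpsC (h a).
Proof. by apply: fpsP => n /=; case: eqP => //; rewrite rmorph0. Qed.

End FpsMap.

(** Completing the square: (1 - 2wf)^2 - (1 - 4uw) = 4w (wf^2 - f + u), and 1 - 2wf has constant
    term 1, which selects the root. *)
Lemma quadratic_fps_sqrt (R : comUnitRingType) (w u f : fps R) :
  (2%:R : R) \is a GRing.unit -> w 0%N = 1 -> u 0%N = 0 -> f 0%N = 0 ->
  w * f ^+ 2 - f + u = 0 ->
  f = (1 - fps_sqrt (1 - 4%:R * u * w)) / (2%:R * w).
Proof.
move=> u2 w0 u0 f0 ef.
have d0 : (1 - 4%:R * u * w) 0%N = 1.
  by rewrite fps_coefD fps_coefN -mulrA fps_coefM big_ord1 [(u * w) _]fps_coefM big_ord1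
    u0 mul0r mulr0 subr0.
have uw : 2%:R * w \is a GRing.unit.
  rewrite -[_ \is a _]/((2%:R * w) 0%N \is a GRing.unit) fps_coefM big_ord1 w0 mulr1.
  by rewrite (_ : fcoef _ _ = 2%:R).
have <- : 1 - 2%:R * w * f = fps_sqrt (1 - 4%:R * u * w).
  apply: fps_sqrt_unique => //.
    rewrite fps_coefD fps_coefN [_ * f]mulrC fps_coefM big_ord1 f0 mul0r.
    by rewrite subr0.
  apply/eqP; rewrite -subr_eq0; apply/eqP.
  transitivity (4%:R * w * (w * f ^+ 2 - f + u)); first by ring.
  by rewrite ef mulr0.
by rewrite opprB addrC subrK mulrC mulKr.
Qed.

(* [w] is the series u / (1 - c u). *)
Lemma fps_homography_coef (R : comNzRingType) (c : R) (w : fps R) m n :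
  w = fpsX R + fpsC c * fpsX R * w ->
  (w ^+ m.+1) n.+1 = c ^+ (n - m) *+ 'C(n, m).
Proof.
move=> wE; have rec k : w ^+ k.+1 = fpsX R * w ^+ k + fpsX R * (fpsC c * w ^+ k.+1).
  by rewrite exprS {1}wE; ring.
have w0 : w 0%N = 0 by rewrite -[w]expr1 rec fps_coefD !fps_coefXM addr0.
elim: n m => [|n IHn] m; rewrite rec fps_coefD !fps_coefXM.
  rewrite fps_coefCM (@fps_coefX_small _ w m.+1) // mulr0 addr0.
  case: m => [|m]; first by rewrite expr0 fps_coef1.
  by rewrite fps_coefX_small // bin_small // mulr0n.
rewrite fps_coefCM IHn; case: m => [|m]; first by rewrite expr0 add0r !bin0 !subn0 exprS.
rewrite IHn subSS binS mulrnDr addrC; congr (_ + _).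
(* The exponent [n - m.+1] is truncated when [n <= m], but then the binomial coefficient is 0. *)
have [lt_mn|le_nm] := ltnP m n; last by rewrite !bin_small ?mulr0n ?mulr0.
by rewrite mulrnAr -exprS -subSn // subSS.
Qed.

(** * The series of the polynomials P_n *)

(** The factors [y] and [y ^+ 2] make each coefficient of the right-hand side depend only on earlier
    coefficients of [C]. *)
Lemma dyck_series_exists (y := fpsX {poly int}) (t := fpsC 'X) :
  exists C : fps {poly int}, C = 1 + y * C ^+ 2 + (t - 1) * y ^+ 2 * C ^+ 2.
Proof.
have [|C CE] := @fps_rec {poly int} (fun s n => if n is m.+1 then
    \sum_(i < m.+1) s i * s (m - i)%N
    + (if m is p.+1 then ('X - 1) * \sum_(i < p.+1) s i * s (p - i)%N else 0) else 1).
  move=> s s' [|m] // ss'.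
  have conv k : (k <= m)%N ->
      \sum_(i < k.+1) s i * s (k - i)%N = \sum_(i < k.+1) s' i * s' (k - i)%N.
    move=> km; apply: eq_bigr => i _; have := ltn_ord i => ik.
    by rewrite !ss' //; lia.
  by rewrite conv //; case: m conv {ss'} => // m conv; rewrite conv.
exists C.
have -> : 1 + y * C ^+ 2 + (t - 1) * y ^+ 2 * C ^+ 2 =
    1 + y * (C * C + y * (fpsC ('X - 1) * (C * C))).
  by rewrite rmorphB rmorph1 -/t; ring.
apply: fpsP => -[|m]; rewrite CE fps_coefD fps_coefXM ?addr0 //.
rewrite fps_coef1 add0r fps_coefD -fps_coefM; congr (_ + _).
by case: m => [|p]; rewrite fps_coefXM ?fps_coefCM.
Qed.

Section DyckSeries.
Variable C : fps {poly int}.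
Let y := fpsX {poly int}.
Let t : fps {poly int} := fpsC 'X.
Hypothesis CE : C = 1 + y * C ^+ 2 + (t - 1) * y ^+ 2 * C ^+ 2.

Lemma dyck_series_coef n : C n = if n is m.+1 then
   \sum_(i < m.+1) C i * C (m - i)%N
   + (if m is p.+1 then ('X - 1) * \sum_(i < p.+1) C i * C (p - i)%N else 0) else 1.
Proof.
have CE' : C = 1 + y * (C * C + y * (fpsC ('X - 1) * (C * C))).
  by rewrite {1}CE rmorphB rmorph1 -/t; ring.
rewrite [in LHS]CE' fps_coefD; case: n => [|m]; rewrite fps_coefXM ?addr0 //.
rewrite fps_coef1 add0r fps_coefD -fps_coefM; congr (_ + _).
by case: m => [|p]; rewrite fps_coefXM ?fps_coefCM.
Qed.

(** The degree bound for Kazhdan-Lusztig polynomials. In the recursion the bounds add up in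
    products, and the factor t - 1 of degree 1 comes with two powers of u. *)
Lemma size_dyck_series n : (2 * (size (C n)).-1 <= n)%N.
Proof.
have szM (p q : {poly int}) a b : (2 * (size p).-1 <= a)%N -> (2 * (size q).-1 <= b)%N ->
    (2 * (size (p * q)%R).-1 <= a + b)%N.
  by move=> pa qb; have := size_polyMleq p q; lia.
have szS (I : finType) (P : pred I) (F : I -> {poly int}) a :
    (forall i, P i -> (2 * (size (F i)).-1 <= a)%N) ->
    (2 * (size (\sum_(i | P i) F i)%R).-1 <= a)%N.
  move=> le; elim/big_ind: _ => //; first by rewrite size_poly0.
  by move=> p q pa qa; have := size_polyD p q; lia.
elim/ltn_ind: n => -[|n] IHn; rewrite dyck_series_coef; first by rewrite size_poly1.
have szC m : (m <= n)%N -> (2 * (size (\sum_(i < m.+1) C i * C (m - i)%N)%R).-1 <= m)%N.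
  move=> mn; apply: szS => i _; have im := ltn_ord i.
  rewrite -[leqRHS](subnKC (m := i)) -1?ltnS //.
  by apply: szM; apply: IHn; lia.
have szD (p q : {poly int}) a : (2 * (size p).-1 <= a)%N -> (2 * (size q).-1 <= a)%N ->
    (2 * (size (p + q)%R).-1 <= a)%N.
  by move=> pa qa; have := size_polyD p q; lia.
apply: szD; first by apply: leq_trans (szC n _) _.
case: n {IHn} szC => [|n] szC; first by rewrite size_poly0.
by rewrite -[n.+2]/(2 + n)%N; apply: szM; [rewrite size_XsubC | apply: szC].
Qed.

(** [B] is Phi(1/t, tu) for Phi = uC, and the equation is that of Phi after this substitution. It is
    checked on coefficients, as [reverse] is multiplicative under the degree bounds. *)
Lemma reverse_dyck_series :
  let B := FPS (fun m => if m is n.+1 then reverse n.+1 (C n) else 0) in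
  (1 - (t - 1) * y) * B ^+ 2 - B + t * y = 0.
Proof.
move=> B; pose K : fps {poly int} := FPS (fun n => reverse n.+1 (C n)).
have BE : B = y * K by apply: fpsP => -[|n]; rewrite fps_coefXM.
have szC n : (size (C n) <= n.+1)%N by have := size_dyck_series n; lia.
have revM m : reverse m.+2 (\sum_(i < m.+1) C i * C (m - i)%N) = (K * K) m.
  rewrite linear_sum fps_coefM; apply: eq_bigr => i _ /=.
  have im := ltn_ord i.
  rewrite -reverseM ?(leq_trans (szC _)) //; congr reverse; lia.
suff KE : K = t + y * (K * K + y * (fpsC (1 - 'X) * (K * K))).
  by rewrite BE {2}KE rmorphB rmorph1 -/t; ring.
apply: fpsP => -[|m]; rewrite fps_coefD fps_coefXM -[K _]/(reverse _ (C _)).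
  rewrite dyck_series_coef addr0; apply/polyP => i; rewrite coef_poly coef1 coefX.
  by case: i => [|[|i]].
rewrite add0r fps_coefD dyck_series_coef linearD [LHS]/= revM; congr (_ + _).
case: m => [|m]; rewrite fps_coefXM ?linear0 //.
(* The factor t - 1 is reversed in degree 1, which gives 1 - t, and the convolution in degree
   [m.+2]. *)
rewrite fps_coefCM -revM -[m.+3]/(1 + m.+2)%N reverseM ?size_XsubC //; last first.
  rewrite size_sum_le // => i _; have im := ltn_ord i.
  by have := size_polyMleq (C i) (C (m - i)%N); have := szC i; have := szC (m - i)%N; lia.
congr (_ * _); rewrite linearB /=.
apply/polyP => i; rewrite coefB !coef_poly !coefE.
by case: i => [|[|i]].
Qed.

Lemma reverse_dyck_poly n : reverse n.+1 (C n) = ('X - 1) ^+ n.+1 +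
  \sum_(k < n.+1) (2%:R * ('X - 1)) ^+ k * C (n - k)%N *+ 'C(n, k).
Proof.
pose c : {poly int} := 2%:R * ('X - 1).
have tE : t - 1 = fpsC ('X - 1) by rewrite rmorphB rmorph1.
(* [geo a] is 1/(1 - au). Hence [w] is u/(1 - 2(t-1)u), and [q] is (t-1)u/(1 - (t-1)u). *)
pose geo (a : {poly int}) : fps {poly int} := FPS (fun n => a ^+ n).
have geoE a : geo a = 1 + fpsC a * y * geo a.
  apply: fpsP => -[|m]; rewrite fps_coefD -mulrA [fpsC a * _]mulrCA fps_coefXM.
    by rewrite addr0.
  by rewrite fps_coef1 add0r fps_coefCM /= exprS.
pose w := y * geo c; pose s := (t - 1) * y; pose q := s * geo ('X - 1).
have wE : w = y + fpsC c * y * w by rewrite /w {1}geoE; ring.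
have w0 : w 0%N = 0 by rewrite /w fps_coefXM.
have qE : q = s + s * q.
  by rewrite {1}/q {1}geoE rmorphB rmorph1 -/t /q /s; ring.
have qX : q = y * ((t - 1) * geo ('X - 1)) by rewrite /q /s; ring.
have cyE : fpsC c * y = 2%:R * s.
  by rewrite /c /s rmorphM rmorphB rmorph1 rmorph_nat -/t; ring.
pose Phi := fps_comp (y * C) w.
have PhiE : Phi = w + Phi ^+ 2 + (t - 1) * w * Phi ^+ 2.
  rewrite /Phi; set P := y * C.
  have e : P = y + P * P + (t - 1) * y * (P * P) by rewrite {1}/P {1}CE /P; ring.
  rewrite {1}e !fps_compD !fps_compM // fps_compX // tE fps_compC.
  by rewrite expr2.
have Psi0 : (Phi + q) 0%N = 0.
  rewrite fps_coefD qX fps_coefXM addr0.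
  by rewrite (@fps_compE _ _ _ 0 1) // big_ord1 fps_coefXM mul0r.
have Psi_eq : (1 - (t - 1) * y) * (Phi + q) ^+ 2 - (Phi + q) + t * y = 0.
  (* The equation of [Phi] multiplied by 1 - 2s, the denominator of [w]. *)
  have ePhi : (1 - 2%:R * s) * Phi - (y + (1 - s) * Phi ^+ 2) = 0.
    transitivity ((1 - 2%:R * s) * (Phi - (w + Phi ^+ 2 + (t - 1) * w * Phi ^+ 2))
      + (w - (y + fpsC c * y * w)) * (1 + (t - 1) * Phi ^+ 2)).
      by rewrite cyE /s; ring.
    by rewrite -PhiE -wE !subrr mulr0 mul0r addr0.
  transitivity (- ((1 - 2%:R * s) * Phi - (y + (1 - s) * Phi ^+ 2))
     + (q - (s + s * q)) * (2%:R * Phi + q - 1)).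
    by rewrite /s; ring.
  by rewrite ePhi -qE subrr oppr0 mul0r addr0.
pose B : fps {poly int} := FPS (fun m => if m is n.+1 then reverse n.+1 (C n) else 0).
have BE : B = Phi + q := fps_quadratic_unique (erefl : B 0%N = 0) Psi0 reverse_dyck_series Psi_eq.
rewrite -[LHS]/(B n.+1) BE.
rewrite fps_coefD addrC; congr (_ + _).
  by rewrite qX fps_coefXM tE fps_coefCM /= exprS.
(* The term of index 0 vanishes with the constant term of [y * C]. Reversing the others pairs
   C_(n-k) with the coefficient of u^(n+1) in w^(n-k+1), which is c^k times C(n,n-k) = C(n,k). *)
rewrite (@fps_compE _ _ _ n.+1 n.+2) // big_ord_recl fps_coefXM mul0r add0r
  (reindex_inj rev_ord_inj).
apply: eq_bigr => k _; have kn := ltn_ord k.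
have -> : nat_of_ord (lift ord0 (rev_ord k)) = (n - k).+1 by rewrite lift0 /= subSS.
rewrite fps_coefXM (fps_homography_coef _ _ wE) subKn -1?ltnS // bin_sub -1?ltnS //.
by rewrite mulrnAr mulrC.
Qed.
End DyckSeries.

(** Multiplying the equation of C by u gives (1 - u + tu) X^2 - X + u = 0 for X = uC. The
    coefficients are moved to [rat] so that 2 becomes invertible. *)
Lemma dyck_series_sqrt (C : fps {poly int}) (u := fpsX {poly rat}) (t := fpsC 'X) :
  C = 1 + fpsX {poly int} * C ^+ 2 + (fpsC 'X - 1) * fpsX {poly int} ^+ 2 * C ^+ 2 ->
  fps_map (map_poly intr) (fpsX {poly int} * C)
    = (1 - fps_sqrt (1 - 4%:R * u * (1 - u + t * u))) / (2%:R * (1 - u + t * u)).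
Proof.
move=> CE; apply: quadratic_fps_sqrt.
- by rewrite -(rmorph_nat (@polyC rat)) poly_unitE size_polyC coefC.
- by rewrite fps_coefD fps_coefD fps_coefN mulrC fps_coefXM addr0 subr0.
- by [].
- by rewrite -[LHS]/(map_poly intr (_ 0%N)) fps_coefXM rmorph0.
have := congr1 (fps_map (map_poly (intr : int -> rat))) CE.
rewrite rmorphM !rmorphD !rmorphM rmorphB rmorph1 /= fps_mapX fps_mapC.
rewrite [fpsC _](_ : _ = t); last by rewrite /t -(map_polyX (intr : int -> rat)).
rewrite -/u; set D := fps_map _ C => DE.
transitivity (u * ((1 + u * D ^+ 2 + (t - 1) * u ^+ 2 * D ^+ 2) - D)); first by ring.
by rewrite !expr2 -DE subrr mulr0.
Qed.

(** * Dyck words *)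

(** Paths from height [h] down to 0, tested step by step so that induction on the word applies. *)
Fixpoint dyck_from (h : nat) (w : seq bool) : bool :=
  match w with
  | [::] => h == 0%N
  | true :: w' => dyck_from h.+1 w'
  | false :: w' => (0 < h)%N && dyck_from h.-1 w'
  end.

Lemma dyck_fromP h w : reflect
  ((h + count id w = count negb w)%N /\
   forall i, (count negb (take i w) <= h + count id (take i w))%N)
  (dyck_from h w).
Proof.
elim: w h => [|[] w IHw] h /=.
- apply: (iffP eqP) => [->|[]]; [by [] | lia].
- apply: (iffP (IHw _)) => -[e le]; split; try lia.
    by case=> [|i] //=; have := le i; lia.
  by move=> i; have := le i.+1 => /=; lia.
case: h => [|h] /=.
  by constructor=> -[_ /(_ 1%N)]; rewrite /= take0.
apply: (iffP (IHw _)) => -[e le]; split; try lia.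
  by case=> [|i] //=; have := le i; lia.
by move=> i; have := le i.+1 => /=; lia.
Qed.

Lemma dyckE w : dyck w = dyck_from 0 w.
Proof.
have cT v : count_mem true v = count id v by apply: eq_count; case.
have cF v : count_mem false v = count negb v by apply: eq_count; case.
rewrite /dyck !cT !cF; apply/andP/dyck_fromP => -[]; rewrite add0n.
  move=> /eqP e /forallP le; split=> // i; rewrite add0n -cT -cF.
  have [lt|ge] := ltnP i (size w).+1; first exact: (le (Ordinal lt)).
  by rewrite take_oversize ?cT ?cF ?e // ltnW.
move=> e le; split; first exact/eqP.
by apply/forallP => i; rewrite cT cF; apply: le.
Qed.

(* The state before a step: 0 after a down step or at the start, 1 after an ascent of
   length 1, and 2 after a long ascent. *)
Definition next_state (s : nat) : nat := if s == 0%N then 1%N else 2%N.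

(** A long ascent is counted at its second up step, when it becomes long. *)
Fixpoint long_from (s : nat) (w : seq bool) : nat :=
  match w with
  | [::] => 0%N
  | true :: w' => ((s == 1%N) + long_from (next_state s) w')%N
  | false :: w' => long_from 0 w'
  end.

Definition starts_long (s : nat) (w : seq bool) (i : nat) : bool :=
  [&& nth false w i, nth false w i.+1 & if i is j.+1 then ~~ nth false w j else s == 0%N].

(** On the right, long ascents are counted at their first step instead. The extra term is for an
    ascent of length 1 begun before [w] and continued by it. *)
Lemma long_fromE s w : long_from s w =
  ((s == 1%N) && nth false w 0 + \sum_(i < size w) starts_long s w i)%N.
Proof.
elim: w s => [|b w IHw] s; first by rewrite big_ord0 /= andbF.
rewrite big_ord_recl /= (eq_bigr (fun i : 'I_(size w) =>
    nat_of_bool (starts_long (if b then 1%N else 0%N) w i))); last first.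
  by move=> [[|i] /= _] _; rewrite /starts_long /=; case: b.
case: b; rewrite /= IHw /starts_long /= ?andbF ?andbT //.
by case: s => [|s] /=; rewrite ?andbF ?andbT ?add0n.
Qed.

Lemma all_take_find v k : all id (take k v) && ~~ nth false v k && (k <= size v)%N
  = (k == find (predC id) v).
Proof.
elim: v k => [|b v IHv] [|k] //=; case: b; rewrite //= ?andbF //.
Qed.

(** An ascent is determined by its start [i]: it ends at [i + r i], where [r i] is the length of the
    run of up steps from [i]. Counting pairs thus amounts to counting starts. *)
Lemma long_ascentsE w : long_ascents w = long_from 0 w.
Proof.
pose r i := find (predC id) (drop i w).
have ascE i j : (i <= size w)%N -> (j <= size w)%N ->
    ascent w i j && (2 <= j - i)%N = starts_long 0 w i && (j == i + r i)%N.
  move=> iw jw; have [ij|ji] := ltnP i j; last first.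
    rewrite /ascent ltnNge ji /=; apply/esym/negP => /andP[st /eqP ej].
    have r0 : r i = 0%N by lia.
    move: st r0; rewrite /r /starts_long => /and3P[wi _ _].
    have := size_drop i w; case ed: (drop i w) => [|b v] /= sd.
      by move: wi; rewrite nth_default //; lia.
    by have := nth_drop i false w 0; rewrite ed addn0 wi /= => ->.
  have := all_take_find (drop i w) (j - i); rewrite nth_drop (subnKC (ltnW ij)).
  rewrite -/(r i) (_ : (j - i <= size (drop i w))%N); last by rewrite size_drop leq_sub2r.
  rewrite andbT => eqr.
  have -> : (j == i + r i) = (j - i == r i)%N by lia.
  rewrite -eqr /ascent ij jw /=.
  (* The default [false] of [nth] makes the end of the word act as a down step. *)
  have -> : (j == size w) || ~~ nth false w j = ~~ nth false w j.
    by case: eqP => // ->; rewrite nth_default.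
  have -> : (i == 0%N) || ~~ nth false w i.-1
      = if i is j.+1 then ~~ nth false w j else true by case: (i).
  rewrite /starts_long; case allw: (all _ _); rewrite ?andbF //=.
  case wj: (nth false w j); rewrite ?andbF // !andbT /=.
  have [lt|ge] := ltnP 1 (j - i); rewrite ?andbF ?andbT.
    have wk k : (k < j - i)%N -> nth false w (i + k).
      move=> kij; rewrite -nth_drop -(nth_take _ kij).
      apply: (allP allw); rewrite mem_nth // size_takel ?size_drop ?leq_sub2r //.
    have := wk 0%N; have := wk 1%N; rewrite lt addn0 addn1 (ltnW lt) => -> // -> //.
  have -> : i.+1 = j by lia.
  by rewrite wj andbF.
rewrite long_fromE /= add0n /long_ascents -sum1_card.
rewrite (eq_bigl (fun ij : 'I_(size w).+1 * 'I_(size w).+1 =>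
   starts_long 0 w ij.1 && (ij.2 == ij.1 + r ij.1 :> nat)%N)); last first.
  by move=> [i j]; rewrite inE /= ascE // -ltnS.
rewrite -(pair_big_dep (fun i : 'I_(size w).+1 => starts_long 0 w i)
  (fun i j : 'I_(size w).+1 => j == i + r i :> nat)%N (fun _ _ => 1%N)) /=.
rewrite big_mkcond big_ord_recr /= {2}/starts_long nth_default //= addn0.
apply: eq_bigr => i _; case: ifP => // _.
have lt : (i + r i < (size w).+1)%N.
  have := find_size (predC id) (drop i w); rewrite size_drop -/(r i).
  by have := ltn_ord i; lia.
by rewrite (big_pred1 (Ordinal lt)).
Qed.

Lemma big_tuple_cons (R : nmodType) (T : finType) n (F : n.+1.-tuple T -> R) :
  \sum_w F w = \sum_x \sum_(w : n.-tuple T) F [tuple of x :: w].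
Proof.
rewrite pair_big /= (reindex (fun p : T * n.-tuple T => [tuple of p.1 :: p.2])) //=.
exists (fun w => (thead w, [tuple of behead w])) => [[x w] _|w _] /=.
  by congr (_, _); apply: val_inj.
by rewrite [RHS]tuple_eta; apply: val_inj.
Qed.

Definition dyck_sum (s h m : nat) : {poly int} :=
  \sum_(w : m.-tuple bool | dyck_from h w) 'X^(long_from s w).

Lemma dyck_sum0 s h : dyck_sum s h 0 = (h == 0%N)%:R.
Proof.
rewrite /dyck_sum big_mkcond (big_pred1 [tuple]) => [|w]; last by apply/esym/eqP/tuple0.
by case: h.
Qed.

Lemma dyck_sumS s h m : dyck_sum s h m.+1 =
  'X^(s == 1%N) * dyck_sum (next_state s) h.+1 m
  + (if h is h'.+1 then dyck_sum 0 h' m else 0).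
Proof.
rewrite /dyck_sum big_mkcond big_tuple_cons big_bool /=; congr (_ + _).
  rewrite mulr_sumr [RHS]big_mkcond /=; apply: eq_bigr => w _.
  by rewrite exprD.
case: h => [|h] /=; first by rewrite big1.
by rewrite [RHS]big_mkcond.
Qed.

Lemma dyck_sum_small s h m : (m < h)%N -> dyck_sum s h m = 0.
Proof.
elim: m s h => [|m IHm] s [|h] // lt; first by rewrite dyck_sum0.
by rewrite dyck_sumS !IHm ?mulr0 ?addr0 //; lia.
Qed.

(** * Enumeration of Dyck words by long ascents *)

Section DyckWords.
Variable C : fps {poly int}.
Let y := fpsX {poly int}.
Let t : fps {poly int} := fpsC 'X.
Hypothesis CE : C = 1 + y * C ^+ 2 + (t - 1) * y ^+ 2 * C ^+ 2.

(* [E s] enumerates the Dyck words by the long ascents completed when reading from [s]. *)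
Lemma dyck_state_series : exists E : nat -> fps {poly int}, E 0%N = C /\
  forall s, E s = 1 + y * (t ^+ (s == 1%N) * (E (next_state s) * C)).
Proof.
have u1 : (1 - y * C) \is a GRing.unit.
  rewrite -[_ \is a _]/(fps_unit (1 - y * C)) /fps_unit fps_coefD fps_coefN fps_coefXM.
  by rewrite oppr0 addr0 unitr1.
pose E2 := (1 - y * C)^-1.
have E2E : E2 * (1 - y * C) = 1 by rewrite mulVr.
(* Words read from states 0 and 1 have different counts only if their first ascent has length 1,
   that is, if they are ud followed by a Dyck word; this gives the correction (t - 1) y C. From
   state 2 on, the equation reads E = 1 + y E C. *)
exists (fun s => if s == 0%N then C else if s == 1%N then C + (t - 1) * y * C else E2).
split=> // -[|[|s]] /=.
- by rewrite expr0 mul1r {1}CE; ring.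
- rewrite expr1; apply: (mulIr u1); apply/eqP; rewrite -subr_eq0; apply/eqP.
  transitivity (C - (1 + y * C ^+ 2 + (t - 1) * y ^+ 2 * C ^+ 2)
    + y * t * C * (1 - E2 * (1 - y * C))); first by ring.
  by rewrite -CE E2E !subrr mulr0 addr0.
- by rewrite expr0 mul1r -{1}E2E; ring.
Qed.

Lemma dyck_series_words n : C n = dyck_sum 0 0 (2 * n).
Proof.
have [E [E0 EE]] := dyck_state_series.
(* A word from height [h] to 0 splits at its first descents below h, h - 1, ..., 1, and all
   its parts but the first are read from state 0. *)
suff words m s h a : m = (2 * a + h)%N -> (E s * C ^+ h) a = dyck_sum s h m.
  by have := words (2 * n)%N 0%N 0%N n; rewrite E0 addn0 expr0 mulr1; apply.
(* The summand [C ^+ h'] stands for an empty word or a first step down, the other one for a first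
   step up. *)
have split_step s' h' : E s' * C ^+ h' = C ^+ h' +
    y * (t ^+ (s' == 1%N) * (E (next_state s') * C ^+ h'.+1)).
  by rewrite {1}EE exprS; ring.
elim: m s h a => [|m IHm] s h a em; rewrite split_step fps_coefD.
  have [-> ->] : a = 0%N /\ h = 0%N by lia.
  by rewrite fps_coefXM expr0 fps_coef1 addr0 dyck_sum0.
rewrite dyck_sumS addrC; congr (_ + _); last first.
  case: h em => [|h] em; first by case: a em.
  by rewrite exprS -{1}E0 IHm //; lia.
case: a em => [|a] em; first by rewrite fps_coefXM dyck_sum_small ?mulr0 //; lia.
rewrite fps_coefXM -rmorphXn fps_coefCM IHm //; lia.
Qed.

Lemma dyck_series_count n k :
  (C n)`_k = #|[set w : (2 * n).-tuple bool | dyck w & long_ascents w == k]|%:Z.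
Proof.
rewrite dyck_series_words coef_sum -natz -sum1_card natr_sum big_mkcond [RHS]big_mkcond.
apply: eq_bigr => w _; rewrite inE dyckE long_ascentsE coefXn eq_sym.
by case: dyck_from; case: eqP.
Qed.
End DyckWords.

(** * Kazhdan-Lusztig polynomials on a lattice of flats *)

(** The hypotheses are the defining recursion of the Moebius function, so a guessed formula only has
    to be checked on sums. *)
Lemma mobius_unique (T : finType) (L : {set {set T}}) (F : {set T}) (s : {set T} -> int) :
  s F = 1 ->
  (forall G, G \in L -> F \proper G ->
     \sum_(H in L | (F \subset H) && (H \subset G)) s H = 0) ->
  forall G, G \in L -> F \subset G -> mobius L F G = s G.
Proof.
move=> sF s0 G; have [n] := ubnP #|G|; elim: n G => // n IHn G leG LG sFG.
rewrite mobiusE; case: eqVneq => [->|nGF]; first by rewrite sF.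
have pFG : F \proper G by rewrite properEneq eq_sym nGF.
apply/esym/eqP; rewrite -addr_eq0; apply/eqP; rewrite -[RHS](s0 G LG pFG).
rewrite [RHS](bigD1 G) ?LG ?sFG ?subxx //=; congr (_ + _).
apply: eq_big => [H|H /and3P[LH sFH pHG]].
  by rewrite properEneq -!andbA [(H != G) && _]andbC.
by rewrite IHn //; apply: leq_trans (proper_card pHG) _.
Qed.

(** The coefficients of [D] are symmetric about r/2, and those at or above r/2 vanish. *)
Lemma reverse_fixed0 r (D : {poly int}) :
  (2 * (size D).-1 < r)%N -> reverse r D = D -> D = 0.
Proof.
move=> szD revD; apply/polyP => i; rewrite coef0.
have big j : (r <= 2 * j)%N -> D`_j = 0.
  by move=> lej; rewrite nth_default //; case: (size D) szD => //=; lia.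
have [/big //|lti] := leqP r (2 * i).
by rewrite -revD coef_poly; case: ifP => // ir; apply: big; lia.
Qed.

(** Makes [M] one of its own contractions, so that a statement about all contractions covers it. *)
Lemma contraction0 (T : finType) (M : matroid T) : contraction M set0 = M.
Proof.
apply: matroid_eq; first by rewrite /= setD0.
apply/setP => I; rewrite inE setD0 setU0 rk0 addn0.
apply/andP/idP => [[_ /eqP rI]|iI]; last by rewrite indep_ground // rk_indep.
have [J [iJ sJ cJ]] := rk_basis M I.
by rewrite -(_ : J = I) //; apply/eqP; rewrite eqEcard sJ cJ rI leqnn.
Qed.

(* Recursion on the lattice of flats of a single matroid; no isomorphism between minors is
   needed. *)
Lemma KL_poly_contraction (T : finType) (M : matroid T) (Q : {set T} -> {poly int}) :
  (forall F, F \in flats M -> rk M F = rank M -> Q F = 1) ->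
  (forall F, F \in flats M -> (rk M F < rank M)%N ->
     (2 * (size (Q F)).-1 < rank M - rk M F)%N) ->
  (forall F, F \in flats M -> reverse (rank M - rk M F) (Q F) =
     \sum_(G in flats M | F \subset G)
        (\sum_(B in flats M | (F \subset B) && (B \subset G))
           mobius (flats M) F B *: 'X^(rk M G - rk M B)) * Q G) ->
  forall F, F \in flats M -> KL_poly (contraction M F) = Q F.
Proof.
move=> Q1 szQ revQ F; have [n] := ubnP (rank M - rk M F).
elim: n F => // n IHn F leF fF.
have sF := flat_ground fF; have rF := rkS M sF; rewrite -/(rank M) in rF.
have [P1 szP revP] := KL_polyP (contraction M F).
move: P1 szP revP; rewrite rank_con //; set P := KL_poly _ => P1 szP revP.
have [e|ne] := eqVneq (rk M F) (rank M).
  by rewrite Q1 // P1 // e subnn.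
have ltF : (rk M F < rank M)%N by rewrite ltn_neqAle ne.
apply/eqP; rewrite -subr_eq0; apply/eqP; apply: (@reverse_fixed0 (rank M - rk M F)).
  have := size_polyD P (- Q F); rewrite size_polyN.
  move: szP (szQ F fF ltF); rewrite subn_gt0 => /(_ ltF).
  move: (size P) (size (Q F)) (size (P - Q F)%R) => a b c; lia.
(* In both recursions the term at [F] has coefficient 1 and the terms above [F] agree by induction,
   so [reverse] fixes the difference. *)
rewrite linearB /= revP revQ // big_flats_contraction //.
have fFF : (F \in flats M) && (F \subset F) by rewrite fF subxx.
rewrite (bigD1 F) //= [X in _ - X](bigD1 F) //=.
rewrite -charpoly_con_loc // charpoly_rank0 ?con_con //; last first.
  rewrite rank_loc; first by rewrite rk_con // subnn.
  by rewrite flats_contraction //; apply: imset_f; rewrite inE.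
rewrite !mul1r -/P opprD addrACA -sumrB big1 ?addr0 // => G /andP[/andP[fG sFG] nGF].
rewrite con_con // charpoly_con_loc // IHn ?subrr //.
have := @flat_rk_lt _ M F G fF; rewrite properEneq eq_sym nGF sFG flat_ground //.
by move=> /(_ isT isT); lia.
Qed.

(** * Flats of a cycle matroid *)

Section CycleMatroidFlats.
Variable V : finType.
Implicit Types (r : rel V) (F I S : {set {set V}}) (x y : V).

Lemma set2_eqP x y a b : [set x; y] = [set a; b] -> (x = a /\ y = b) \/ (x = b /\ y = a).
Proof.
move=> e; have : x \in [set a; b] by rewrite -e set21.
have : y \in [set a; b] by rewrite -e set22.
have : a \in [set x; y] by rewrite e set21.
have : b \in [set x; y] by rewrite e set22.
rewrite !inE; do 4![case/orP=> /eqP ?]; subst; by [left | right].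
Qed.

Definition edge_set r : {set {set V}} := [set [set p.1; p.2] | p : V * V & r p.1 p.2].

Lemma joins_edge_set r : symmetric r -> joins (edge_set r) =2 r.
Proof.
move=> rsym x y; apply/imsetP/idP => [[[a b]]|rxy]; last by exists (x, y); rewrite ?inE.
by rewrite inE /= => rab /set2_eqP[[-> ->]|[-> ->]]; rewrite // rsym.
Qed.

Lemma edge_setS r r' : symmetric r' ->
  (edge_set r \subset edge_set r') = [forall x, forall y, r x y ==> r' x y].
Proof.
move=> rsym; apply/subsetP/'forall_'forall_implyP => [sub x y rxy|sub e].
  rewrite -(joins_edge_set rsym); apply: sub.
  by apply/imsetP; exists (x, y); rewrite ?inE.
move=> /imsetP[[x y] /=]; rewrite inE /= => rxy ->.
by apply/imsetP; exists (x, y); rewrite ?inE //=; apply: sub.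
Qed.

Lemma subset_edge_set (G : sgraph V) F r : F \subset edges G -> symmetric r ->
  (forall x y, r x y -> G x y) -> (forall x y, G x y -> joins F x y = r x y) ->
  F = edge_set r.
Proof.
move=> sF rsym rG Fr; apply/setP => e; apply/idP/imsetP => [Fe|[[x y]]].
  have /edgesP[x [y [Gxy _ ee]]] := subsetP sF e Fe.
  by exists (x, y); rewrite ?inE //= -Fr // /joins -ee.
by rewrite inE /= => rxy ->; have := Fr x y (rG _ _ rxy); rewrite rxy.
Qed.

Variable G : sgraph V.
Let M := cycle_matroid G.

Lemma basis_connect F I : F \subset edges G -> I \in indep M -> I \subset F ->
  #|I| = rk M F -> forall x y, [set x; y] \in F -> connect (joins I) x y.
Proof.
move=> sF iI sI cI x y Fxy; apply: contraT => nc.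
have nI : [set x; y] \notin I by apply: contraNN nc => Ixy; apply: connect1.
have : (#|[set x; y] |: I| <= rk M F)%N.
  apply: leq_rk; last by rewrite subUset sub1set Fxy.
  move: iI; rewrite !inE subUset sub1set (subsetP sF) //= => /andP[-> aI].
  exact: acyclic_add.
by rewrite cardsU1 nI cI add1n ltnn.
Qed.

(** By the exchange argument [leq_acyclic], no forest in [F] is larger than a spanning one. *)
Lemma rk_spanning F I : F \subset edges G -> I \subset F -> acyclic I ->
  (forall x y, [set x; y] \in F -> connect (joins I) x y) -> rk M F = #|I|.
Proof.
move=> sF sI aI spI; have sIG := subset_trans sI sF.
apply/eqP; rewrite eqn_leq leq_rk ?inE ?sIG // andbT.
have [J [iJ sJ <-]] := rk_basis M F; move: iJ; rewrite inE => /andP[sJG aJ].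
by apply: leq_acyclic sJG aJ _ => // x y /(subsetP sJ)/spI.
Qed.

(** A basis [I] of [F] has the same components as [F]. An edge inside a component leaves [I]
    spanning; an edge between two components extends [I] to a larger forest. *)
Lemma rk_add_edge F x y : F \subset edges G -> G x y ->
  (rk M F < rk M ([set x; y] |: F))%N = ~~ connect (joins F) x y.
Proof.
move=> sF Gxy; have [I [iI sI cI]] := rk_basis M F.
have spI := basis_connect sF iI sI cI.
have exy : [set x; y] \in edges G by apply/imsetP; exists (x, y); rewrite ?inE.
move: iI; rewrite inE => /andP[sIG aI].
have IF u v : connect (joins I) u v = connect (joins F) u v.
  apply/idP/idP; last by apply: connect_sub => a b; apply: spI.
  by apply: connect_sub => a b Iab; apply: connect1; apply: (subsetP sI).
rewrite -IF; have [cxy|nc] := boolP (connect _ x y).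
  apply/negbTE; rewrite -leqNgt -cI (@rk_spanning _ I) //.
  - by rewrite subUset sub1set exy.
  - by apply: subset_trans sI (subsetUr _ _).
  move=> u v; rewrite in_setU1 => /orP[/eqP/set2_eqP[[-> ->]|[-> ->]]|/spI] //.
  by rewrite joins_connect_sym.
have nI : [set x; y] \notin I by apply: contraNN nc => Ixy; apply: connect1.
rewrite -cI -[X in (X <= _)%N]add1n -[1%N]/(true : nat) -nI -cardsU1.
apply: leq_rk; last exact: setUS.
by rewrite inE subUset sub1set exy sIG acyclic_add.
Qed.

Lemma flat_cycleP F : reflect (F \subset edges G /\
    forall x y, G x y -> connect (joins F) x y -> [set x; y] \in F) (F \in flats M).
Proof.
apply: (iffP (flatP _ _)) => -[sF fF]; split=> //.
  move=> x y Gxy cxy; apply: contraLR cxy => nF; rewrite -rk_add_edge //; apply: fF => //.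
  by apply/imsetP; exists (x, y); rewrite ?inE.
move=> e Ge nFe; have /edgesP[x [y [Gxy _ ee]]] := Ge; rewrite ee rk_add_edge //.
by apply: contraNN nFe => /(fF _ _ Gxy); rewrite ee.
Qed.

(** Every edge has an end of degree 1, whereas each vertex of a cycle has two distinct
    neighbours. *)
Lemma acyclic_leaf S : (forall x y, joins S x y ->
    (forall z, joins S x z -> z = y) \/ (forall z, joins S y z -> z = x)) -> acyclic S.
Proof.
move=> leaf; apply/acyclicP => -[|x [|y [|z p]]] // uc _.
apply/negP; rewrite /= rcons_path => /and4P[xy yz _ lx].
move: uc; rewrite /= !inE !negb_or => /and3P[/and3P[_ xz _] /andP[yz' yp] _].
case: (leaf x y xy) => [/(_ (last z p)) | /(_ z yz) ez]; last by rewrite ez eqxx in xz.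
rewrite joins_sym => /(_ lx) ey; have := mem_last z p.
by rewrite ey inE (negPf yz') (negPf yp).
Qed.

Lemma connect_colour (C : eqType) (col : V -> C) S x y :
  (forall u v, joins S u v -> col u = col v) -> connect (joins S) x y -> col x = col y.
Proof.
move=> colS; have /closed_connect cl : closed (joins S) [pred v | col v == col x].
  by move=> u v /colS e; rewrite !inE e.
by move=> /cl; rewrite !inE eqxx => /esym/eqP.
Qed.

End CycleMatroidFlats.

(** * Flats and ranks of the thagomizer matroid *)

Section ThagomizerFlats.
Variable n : nat.
Let V := (bool + 'I_n)%type.
Let M := thagomizer n.

(* [inl U] is the flat consisting of AB and of all edges at the vertices in [U];
   [inr f] is the flat consisting of the edges joining [i] to [a] with [f i = Some a]. *)
Definition thag_flat := ({set 'I_n} + {ffun 'I_n -> option bool})%type.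
Implicit Types (U : {set 'I_n}) (f g : {ffun 'I_n -> option bool}) (x y : thag_flat).

Definition flat_rel x : rel V := fun u v =>
  match x, u, v with
  | inl _, inl a, inl b => a != b
  | inl U, inl _, inr i | inl U, inr i, inl _ => i \in U
  | inr f, inl a, inr i | inr f, inr i, inl a => f i == Some a
  | _, _, _ => false
  end.

Lemma flat_rel_sym x : symmetric (flat_rel x).
Proof. by case: x => [U|f] [a|i] [b|j] //=; rewrite eq_sym. Qed.

Lemma flat_rel_sub x u v : flat_rel x u v -> thagomizer_rel u v.
Proof. by case: x u v => [U|f] [a|i] [b|j]. Qed.

Definition edges_of x : {set {set V}} := edge_set (flat_rel x).

Lemma joins_edges_of x : joins (edges_of x) =2 flat_rel x.
Proof. exact: joins_edge_set (flat_rel_sym x). Qed.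

Definition spikes f : {set 'I_n} := [set i | f i != None].

(** Inclusion of flats in terms of their labels, see [edges_ofS]; between partial maps it is
    extension. *)
Definition flat_le : rel thag_flat := fun x y =>
  match x, y with
  | inl U, inl U' => U \subset U'
  | inr f, inl U => spikes f \subset U
  | inr f, inr g => [forall i in spikes f, g i == f i]
  | inl _, inr _ => false
  end.

Lemma edges_ofS x y : (edges_of x \subset edges_of y) = flat_le x y.
Proof.
rewrite edge_setS; last exact: flat_rel_sym.
case: x y => [U|f] [U'|g] /=.
- apply/'forall_'forall_implyP/subsetP => [h i iS|h].
    exact: (h (inl false) (inr i)).
  by case=> [a|i] [b|j] //=; apply: h.
- by apply/negP => /'forall_'forall_implyP/(_ (inl false) (inl true)) /= /(_ isT).
- apply/'forall_'forall_implyP/subsetP => [h i|h].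
    rewrite inE; case fi: (f i) => [a|] // _.
    by apply: (h (inl a) (inr i)); rewrite /= fi.
  by case=> [a|i] [b|j] //= /eqP fi; apply: h; rewrite inE fi.
apply/'forall_'forall_implyP/'forall_implyP => [h i|h].
  rewrite inE; case fi: (f i) => [a|] // _.
  by apply: (h (inl a) (inr i)); rewrite /= fi.
by case=> [a|i] [b|j] //= /eqP fi; rewrite -fi; apply: h; rewrite inE fi.
Qed.

Lemma flat_le_anti : antisymmetric flat_le.
Proof.
case=> [U|f] [U'|g] /=; rewrite ?andbF //.
  by rewrite -eqEsubset => /eqP->.
move=> /andP[/'forall_implyP fg /'forall_implyP gf].
congr inr; apply/ffunP => i; have := fg i; have := gf i; rewrite !inE.
case: (f i) (g i) => [a|] [b|] //= gfi fgi; first exact/eqP/gfi.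
  by have := fgi isT.
by have := gfi isT.
Qed.

Lemma edges_of_inj : injective edges_of.
Proof.
by move=> x y e; apply: flat_le_anti; rewrite -!edges_ofS e subxx.
Qed.

Lemma edges_of_sub x : edges_of x \subset ground M.
Proof.
rewrite edge_setS; last exact: thagomizer_rel_sym.
by apply/'forall_'forall_implyP => u v; apply: flat_rel_sub.
Qed.

Lemma edges_of_flat x : edges_of x \in flats M.
Proof.
apply/flat_cycleP; split=> [|u v Guv cuv]; first exact: edges_of_sub.
rewrite -/(joins _ u v) joins_edges_of.
(* [col] sends a vertex to a representative of its component in the flat. *)
pose col (v : V) : V := match x, v with
  | inl U, inr i => if i \in U then inl false else inr i
  | inl _, inl _ => inl false
  | inr f, inr i => if f i is Some a then inl a else inr i
  | inr f, inl a => inl a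
  end.
have : col u = col v.
  apply: connect_colour cuv => u' v'; rewrite joins_edges_of.
  by rewrite /col; case: (x) u' v' => [U|f] [a|i] [b|j] //= => [->|->|/eqP->|/eqP->].
move: Guv; rewrite /col; case: (x) u v {cuv} => [U|f] [a|i] [b|j] //=.
- by case: ifP.
- by case: ifP.
- by move=> /negPf nab [] ab; rewrite ab eqxx in nab.
- by case: (f j) => // c _ [->].
- by case: (f i) => // c _ [->].
Qed.

(** A flat with two edges of a triangle contains the third. So if it contains AB, each [i] is joined
    to both A and B or to neither; otherwise [i] is joined to at most one of them. *)
Lemma flats_thagomizer F : F \in flats M -> exists x, F = edges_of x.
Proof.
move=> /flat_cycleP[sF fF];
have c1 u v : joins F u v -> connect (joins F) u v := @connect1 _ (joins F) u v.
have cl u v w : joins F u v -> joins F v w -> thagomizer_rel u w -> joins F u w.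
  by move=> uv vw; move=> Guw; apply: fF => //; apply: connect_trans (c1 _ _ uv) (c1 _ _ vw).
have js := joins_sym F.
have [AB|nAB] := boolP (joins F (inl false) (inl true)).
  exists (inl [set i | joins F (inl false) (inr i)]).
  have eB i : joins F (inl true) (inr i) = joins F (inl false) (inr i).
    by apply/idP/idP => h; [apply: (cl _ (inl true)) | apply: (cl _ (inl false))]; rewrite // js.
  apply: (subset_edge_set sF); [exact: flat_rel_sym | exact: flat_rel_sub |].
  case=> [[]|i] [[]|j] //= _; rewrite ?inE ?eB // 1?js ?eB //.
exists (inr [ffun i => if joins F (inl false) (inr i) then Some false
                       else if joins F (inl true) (inr i) then Some true else None]).
have nB i : joins F (inl false) (inr i) -> joins F (inl true) (inr i) = false.
  move=> Ai; apply: contraNF nAB => Bi; apply: (cl _ (inr i)) => //; by rewrite js.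
have eAB i b : joins F (inl b) (inr i) = ((if joins F (inl false) (inr i) then Some false
      else if joins F (inl true) (inr i) then Some true else None) == Some b).
  case: b; last by case: ifP => // _; case: ifP.
  by case: ifP => [/nB|_]; last case: ifP.
apply: (subset_edge_set sF); [exact: flat_rel_sym | exact: flat_rel_sub |].
case=> [a|i] [b|j] //=; rewrite ?ffunE.
- by case: a b => [] [] //= _; rewrite ?(negPf nAB) // js (negPf nAB).
- by rewrite eAB.
- by rewrite js eAB.
Qed.

Lemma big_flats_thagomizer (R : nmodType) (P : pred {set {set V}}) (h : {set {set V}} -> R) :
  \sum_(F in flats M | P F) h F = \sum_(x | P (edges_of x)) h (edges_of x).
Proof.
rewrite (eq_bigl (fun F => (F \in edges_of @: setT) && P F)); last first.
  move=> F; congr (_ && _); apply/idP/imsetP => [/flats_thagomizer[x ->]|[x _ ->]].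
    by exists x.
  exact: edges_of_flat.
rewrite big_mkcondr big_imset /=; last by move=> x y _ _; apply: edges_of_inj.
by rewrite -big_mkcondr; apply: eq_bigl => x; rewrite in_setT.
Qed.

Definition flat_rank x : nat :=
  match x with inl U => #|U|.+1 | inr f => #|spikes f| end.

Lemma acyclic_edges_of f : acyclic (edges_of (inr f)).
Proof.
apply: acyclic_leaf => u v; rewrite joins_edges_of.
case: u v => [a|i] [b|j] //= /eqP fi; [right | left] => w; rewrite joins_edges_of.
  by case: w => [c|k] //=; rewrite fi => /eqP[->].
by case: w => [c|k] //=; rewrite fi => /eqP[->].
Qed.

Lemma card_edges_of f : #|edges_of (inr f)| = #|spikes f|.
Proof.
pose e i : {set V} := [set inl (odflt false (f i)); inr i].
have -> : edges_of (inr f) = e @: spikes f.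
  apply/setP => E; apply/imsetP/imsetP => [[[u v]]|[i]]; rewrite inE /=.
    case: u v => [a|i] [b|j] //= /eqP fi ->.
      by exists j; rewrite ?inE /e ?fi.
    by exists i; rewrite ?inE /e ?fi //= setUC.
  rewrite /e => + ->; case fi: (f i) => [a|] // _.
  by exists (inl a, inr i); rewrite ?inE /= ?fi.
by rewrite card_imset // => i j /set2_eqP[[_ [->]]|[]].
Qed.

Lemma rk_edges_of x : rk M (edges_of x) = flat_rank x.
Proof.
case: x => [U|f] /=; last first.
  rewrite rk_indep ?card_edges_of // inE acyclic_edges_of.
  by rewrite (edges_of_sub (inr f)).
(* The spanning tree consists of AB and the edges from A to the vertices of [U]. *)
pose f : {ffun 'I_n -> option bool} := [ffun i => if i \in U then Some false else None].
have sup : spikes f = U.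
  by apply/setP => i; rewrite inE ffunE; case: ifP.
pose I := [set inl false; inl true] |: edges_of (inr f).
have nI : [set inl false; inl true] \notin edges_of (inr f).
  by rewrite -/(joins _ _ _) joins_edges_of.
have cI : #|I| = #|U|.+1 by rewrite cardsU1 nI card_edges_of sup.
have joI u v : joins I u v = ([set u; v] == [set inl false; inl true]) || flat_rel (inr f) u v.
  by rewrite /joins in_setU1 -[_ \in edges_of _]/(joins _ u v) joins_edges_of.
rewrite -cI; apply: rk_spanning; first exact: edges_of_sub.
- rewrite subUset sub1set -/(joins _ _ _) joins_edges_of edges_ofS /=.
  by rewrite sup.
- apply: acyclic_add; first exact: acyclic_edges_of.
  (* Only B gets the colour [true], and all edges of the star at A avoid B. *)
  apply/negP => /(@connect_colour _ _ (fun v : V => match v with inl a => a | inr _ => false end)).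
  suff h u v : joins (edges_of (inr f)) u v ->
      match u with inl a => a | inr _ => false end = match v with inl a => a | inr _ => false end.
    by move/(_ h).
  rewrite joins_edges_of; case: u v => [a|i] [b|j] //=; rewrite ffunE.
    by case: ifP => // _ /eqP[<-].
  by case: ifP => // _ /eqP[<-].
have AB : connect (joins I) (inl true) (inl false).
  by apply: connect1; rewrite joI setUC eqxx.
have Ai i : i \in U -> connect (joins I) (inl false) (inr i).
  by move=> iS; apply: connect1; rewrite joI /= ffunE iS orbT.
have ai a i : i \in U -> connect (joins I) (inl a) (inr i).
  by move=> iS; case: a; [apply: connect_trans AB _|]; apply: Ai.
move=> u v; rewrite -/(joins _ u v) joins_edges_of.
case: u v => [a|i] [b|j] //=.
- by case: a b => [] [] // _; rewrite // joins_connect_sym.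
- exact: ai.
- by rewrite joins_connect_sym; apply: ai.
Qed.

Lemma groundE : ground M = edges_of (inl setT).
Proof.
apply: (@subset_edge_set _ (thagomizer_graph n)) => //; first exact: flat_rel_sym.
  exact: flat_rel_sub.
move=> u v Guv; rewrite (@joins_edge_set _ (@thagomizer_rel n)); last exact: thagomizer_rel_sym.
by case: u v {Guv} => [a|i] [b|j] //=; rewrite inE.
Qed.

Lemma rank_thagomizer : rank M = n.+1.
Proof. by rewrite /rank groundE rk_edges_of /= cardsT card_ord. Qed.

End ThagomizerFlats.

(** * Sums over intervals of flats *)

Lemma big_subsets_card (T : finType) (R : nmodType) (E : {set T}) (h : nat -> R) :
  \sum_(D : {set T} | D \subset E) h #|D| = \sum_(k < #|E|.+1) h k *+ 'C(#|E|, k).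
Proof.
rewrite (partition_big (fun D : {set T} => inord #|D| : 'I_#|E|.+1) xpredT) //=.
apply: eq_bigr => k _; rewrite -cards_draws -sumr_const; apply: eq_big => [D|D].
  rewrite inE; case sDE: (D \subset E) => //=.
  by rewrite -val_eqE /= inordK // ltnS subset_leq_card.
move=> /andP[sDE /eqP <-]; rewrite inordK // ltnS subset_leq_card //.
Qed.

Lemma big_interval_card (T : finType) (R : nmodType) (U0 U1 : {set T}) (h : nat -> R) :
  U0 \subset U1 ->
  \sum_(U : {set T} | (U0 \subset U) && (U \subset U1)) h #|U| =
  \sum_(k < (#|U1| - #|U0|).+1) h (#|U0| + k)%N *+ 'C(#|U1| - #|U0|, k).
Proof.
move=> s01; rewrite -cardsDS // -(big_subsets_card _ (fun k => h (#|U0| + k)%N)).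
rewrite (reindex_onto (fun D => U0 :|: D) (fun U => U :\: U0)) /=; last first.
  by move=> U /andP[sU _]; rewrite setUC setDK_sub.
apply: eq_big => [D|D].
  rewrite subsetUl subUset s01 /= setDUl setDv set0U subsetD.
  case sD: (D \subset U1) => //=; apply/eqP/idP => [<-|dD]; last exact/setDidPl.
  by rewrite disjoint_sym -setI_eq0 setIDA -setIDAC setDv set0I.
rewrite subUset /= setDUl setDv set0U => /andP[_ /eqP eD].
by rewrite cardsU -{2}eD setIDA -setIDAC setDv set0I cards0 subn0.
Qed.

Lemma signr_exp2 (R : comNzRingType) k : (-1) ^+ k *+ 2 ^ k = (- 2%:R) ^+ k :> R.
Proof. by rewrite -[LHS]mulr_natr natrX -exprMn mulN1r. Qed.

Section ThagomizerSums.
Variable n : nat.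
Let M := thagomizer n.
Implicit Types (U : {set 'I_n}) (f g b : {ffun 'I_n -> option bool}) (x y z : thag_flat n).

Lemma spikes_le f g : flat_le (inr f) (inr g) -> spikes f \subset spikes g.
Proof.
move=> /'forall_implyP fg; apply/subsetP => i fi.
by have := fg i fi; move: fi; rewrite !inE => + /eqP->.
Qed.

(** A partial map below [g] is the restriction of [g] to its support, so the interval is Boolean. *)
Lemma big_below_card (R : nmodType) f g (h : nat -> R) : flat_le (inr f) (inr g) ->
  \sum_(b | flat_le (inr f) (inr b) && flat_le (inr b) (inr g)) h #|spikes b| =
  \sum_(k < (#|spikes g| - #|spikes f|).+1)
     h (#|spikes f| + k)%N *+ 'C(#|spikes g| - #|spikes f|, k).
Proof.
move=> fg; rewrite -big_interval_card ?spikes_le //.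
pose res U : {ffun 'I_n -> option bool} := [ffun i => if i \in U then g i else None].
rewrite (reindex_onto res (@spikes n)) /=; last first.
  move=> b /andP[_ /'forall_implyP bg]; apply/ffunP => i; rewrite ffunE.
  by case: ifP => [/bg/eqP //|]; rewrite inE => /negbFE/eqP.
have supE U : spikes (res U) = U :&: spikes g.
  by apply/setP => i; rewrite !inE ffunE; case: ifP.
apply: eq_big => [U|U /andP[_ /eqP->] //]; rewrite supE.
have -> : [forall i in U :&: spikes g, g i == res U i].
  by apply/'forall_implyP => i; rewrite inE ffunE => /andP[-> _].
rewrite andbT; apply/andP/andP => [[/'forall_implyP fU /eqP/setIidPl sU]|[sfU sUg]].
  split=> //; apply/subsetP => i fi; have := fU i fi; move: fi; rewrite inE ffunE.
  by case: ifP => // _ + /eqP e; rewrite -e.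
split; last by rewrite (setIidPl sUg).
apply/'forall_implyP => i fi; rewrite ffunE (subsetP sfU) //.
by have /'forall_implyP/(_ i fi) := fg.
Qed.

(** Each vertex of [U] outside the support of [f] has a free choice between two values; [F i] is the
    set of values allowed at [i]. *)
Lemma card_extensions f U : spikes f \subset U ->
  #|[pred g | flat_le (inr f) (inr g) && (spikes g == U)]| = (2 ^ (#|U| - #|spikes f|))%N.
Proof.
move=> sfU; pose F i : pred (option bool) :=
  if i \in spikes f then pred1 (f i) else if i \in U then predC1 None else pred1 None.
transitivity #|family F|.
  apply: eq_card => g; rewrite !inE; apply/andP/familyP => [[/'forall_implyP fg /eqP gU] i|gF].
    rewrite /F; case: ifP => [/fg //|_]; rewrite -gU inE.
    by case: ifP => // /negbFE.
  split; first by apply/'forall_implyP => i fi; have := gF i; rewrite /F fi.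
  apply/eqP/setP => i; have gFi := gF i; rewrite inE; move: gFi; rewrite /F.
  case: ifP => [fi /eqP->|_]; first by rewrite (subsetP sfU) //; move: fi; rewrite inE.
  by case: ifP => _; rewrite !inE // => /eqP->.
rewrite card_family foldrE big_map big_enum /=.
rewrite -cardsDS // -prod_nat_const [RHS]big_mkcond /=; apply: eq_bigr => i _.
rewrite inE /F; case: ifP => [_|_] /=; first by rewrite card1.
case: ifP => _; last by rewrite card1.
by have := cardC1 (None : option bool); rewrite card_option card_bool.
Qed.

Lemma big_extensions_card (R : nmodType) f U (h : nat -> R) : spikes f \subset U ->
  \sum_(g | flat_le (inr f) (inr g) && (spikes g \subset U)) h #|spikes g| =
  \sum_(k < (#|U| - #|spikes f|).+1)
     h (#|spikes f| + k)%N *+ (2 ^ k * 'C(#|U| - #|spikes f|, k)).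
Proof.
move=> sfU; have := big_interval_card (fun m => h m *+ 2 ^ (m - #|spikes f|)) sfU.
under [X in _ = X -> _]eq_bigr => k _ do rewrite addKn -mulrnA.
move=> <-.
rewrite (partition_big (@spikes n) (fun V => (spikes f \subset V) && (V \subset U))) /=;
  last by move=> g /andP[fg ->]; rewrite spikes_le.
apply: eq_bigr => V /andP[sfV sVU]; rewrite -card_extensions // -sumr_const.
apply: eq_big => [g|g /andP[_ /eqP->] //]; rewrite inE /= -andbA; congr (_ && _).
by case: eqP => [->|]; rewrite ?sVU ?andbF.
Qed.

Lemma sum_binomial (R : comNzRingType) (a : R) d :
  \sum_(k < d.+1) a ^+ k *+ 'C(d, k) = (1 + a) ^+ d.
Proof. by rewrite exprDn; apply: eq_bigr => k _; rewrite expr1n mul1r. Qed.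

Lemma sum_binomial_poly (a : int) d :
  \sum_(k < d.+1) a ^+ k *: 'X^(d - k) *+ 'C(d, k) = ('X + a%:P) ^+ d.
Proof.
by rewrite exprDn; apply: eq_bigr => k _; rewrite -polyC_exp mulrC mul_polyC.
Qed.

(** * Moebius function and characteristic polynomials of intervals *)

Definition flat_of (F : {set {set bool + 'I_n}}) : thag_flat n :=
  odflt (inl set0) [pick x | edges_of x == F].

Lemma edges_ofK : cancel (@edges_of n) flat_of.
Proof.
move=> x; rewrite /flat_of; case: pickP => [y /eqP/edges_of_inj //|/(_ x)].
by rewrite eqxx.
Qed.

(** Intervals between flats of the same kind are Boolean. In the mixed case the value at a set must
    cancel those of the 2^k partial maps with this support, each equal to (-1)^k, where k is the
    number of vertices added to the support of [f]. *)
Definition thag_mobius x y : int :=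
  match x, y with
  | inl U, inl U' => (-1) ^+ (#|U'| - #|U|)
  | inr f, inr g => (-1) ^+ (#|spikes g| - #|spikes f|)
  | inr f, inl U => - (- 2%:R) ^+ (#|U| - #|spikes f|)
  | inl _, inr _ => 0
  end.

Lemma big_interval_inl (R : nmodType) U U' (h : thag_flat n -> R) :
  \sum_(z | flat_le (inl U) z && flat_le z (inl U')) h z =
  \sum_(V : {set 'I_n} | (U \subset V) && (V \subset U')) h (inl V).
Proof. by rewrite big_sumType /= [X in _ + X]big1 ?addr0 // => b /andP[]. Qed.

Lemma big_interval_inr (R : nmodType) f g (h : thag_flat n -> R) :
  \sum_(z | flat_le (inr f) z && flat_le z (inr g)) h z =
  \sum_(b | flat_le (inr f) (inr b) && flat_le (inr b) (inr g)) h (inr b).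
Proof. by rewrite big_sumType /= big1 ?add0r // => b /andP[]. Qed.

Lemma flat_le_rank x y : flat_le x y -> x != y -> (flat_rank x < flat_rank y)%N.
Proof.
move=> xy nxy; rewrite -!rk_edges_of; apply: flat_rk_lt; rewrite ?edges_of_flat //.
  by rewrite properEneq edges_ofS xy (inj_eq (@edges_of_inj n)) nxy.
exact: edges_of_sub.
Qed.

(** By [mobius_unique] it suffices that the sums vanish: they are (1 - 1)^d with d > 0 in the
    Boolean cases, and in the mixed case the two kinds of flats cancel for each k. *)
Lemma mobius_thagomizer x y : flat_le x y ->
  mobius (flats M) (edges_of x) (edges_of y) = thag_mobius x y.
Proof.
move=> xy; rewrite -[in RHS](edges_ofK y).
apply: (@mobius_unique _ (flats M) _ (fun G => thag_mobius x (flat_of G)));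
  rewrite ?edges_of_flat ?edges_ofS //.
  by rewrite edges_ofK; case: (x) => [U|f]; rewrite /= subnn.
move=> _ /flats_thagomizer[{xy}y ->].
rewrite properEneq edges_ofS (inj_eq (@edges_of_inj n)) => /andP[nxy xy].
rewrite (@big_flats_thagomizer n _ (fun H => (edges_of x \subset H) && (H \subset edges_of y))).
under eq_bigl => z do rewrite !edges_ofS.
under eq_bigr => z _ do rewrite edges_ofK.
have := flat_le_rank xy nxy.
case: x y xy {nxy} => [U|f] [U'|g] //= xy; rewrite ?ltnS => ltr.
- rewrite big_interval_inl (big_interval_card (fun m => (-1) ^+ (m - #|U|))) //.
  under eq_bigr => k _ do rewrite addKn.
  by rewrite sum_binomial subrr expr0n subn_eq0 leqNgt ltr.
- rewrite big_sumType /= (big_interval_card (fun m => - (- 2%:R) ^+ (m - #|spikes f|))) //.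
  rewrite (big_extensions_card (fun m => (-1) ^+ (m - #|spikes f|))) //.
  rewrite -big_split big1 //= => k _; rewrite addKn mulrnA mulNrn addrC; apply/eqP.
  rewrite subr_eq0; apply/eqP; congr (_ *+ _).
  exact: signr_exp2.
rewrite big_interval_inr (big_below_card (fun m => (-1) ^+ (m - #|spikes f|))) //.
under eq_bigr => k _ do rewrite addKn.
by rewrite sum_binomial subrr expr0n subn_eq0 leqNgt ltr.
Qed.

(** For [flat_le x y], the characteristic polynomial of the minor between the two flats, in the form
    of [charpoly_con_loc]. *)
Definition thag_kernel x y : {poly int} := \sum_(z | flat_le x z && flat_le z y)
  thag_mobius x z *: 'X^(flat_rank y - flat_rank z).

Lemma thag_kernel_inl U U' : U \subset U' ->
  thag_kernel (inl U) (inl U') = ('X - 1) ^+ (#|U'| - #|U|).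
Proof.
move=> s; rewrite /thag_kernel big_interval_inl /=.
rewrite (big_interval_card (fun m => (-1) ^+ (m - #|U|) *: 'X^(#|U'|.+1 - m.+1))) //.
rewrite -polyCN -sum_binomial_poly; apply: eq_bigr => k _.
by rewrite addKn subSS subnDA.
Qed.

Lemma thag_kernel_inr f g : flat_le (inr f) (inr g) ->
  thag_kernel (inr f) (inr g) = ('X - 1) ^+ (#|spikes g| - #|spikes f|).
Proof.
move=> fg; rewrite /thag_kernel big_interval_inr /=.
rewrite (big_below_card (fun m => (-1) ^+ (m - #|spikes f|) *: 'X^(#|spikes g| - m))) //.
rewrite -polyCN -sum_binomial_poly; apply: eq_bigr => k _.
by rewrite addKn subnDA.
Qed.

(** With d the number of vertices of [U] outside the support of [f], the partial maps contribute t
    (t - 2)^d and the sets -(t - 2)^d. *)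
Lemma thag_kernel_inrl f U : spikes f \subset U ->
  thag_kernel (inr f) (inl U) = ('X - 1) * ('X - 2%:R) ^+ (#|U| - #|spikes f|).
Proof.
move=> s; rewrite /thag_kernel big_sumType /=.
rewrite (big_interval_card (fun m => - (- 2%:R) ^+ (m - #|spikes f|) *: 'X^(#|U|.+1 - m.+1))) //.
rewrite (big_extensions_card (fun m => (-1) ^+ (m - #|spikes f|) *: 'X^(#|U|.+1 - m))) //.
rewrite (_ : 'X - 2%:R = 'X + (- 2%:R : int)%:P) -?sum_binomial_poly; last first.
  by rewrite polyCN -(rmorph_nat (@polyC int)).
rewrite mulrBl mul1r addrC mulr_sumr.
rewrite -sumrN; congr (_ + _); apply: eq_bigr => k _; have kd := ltn_ord k.
  rewrite addKn mulrnA mulrnAr; congr (_ *+ _).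
  rewrite -scalerAr -exprS scalerMnl signr_exp2.
  by rewrite subSn ?subnDA // -leq_subRL ?subset_leq_card // -ltnS.
by rewrite addKn subSS subnDA scaleNr mulNrn.
Qed.

End ThagomizerSums.

(** * Kazhdan-Lusztig polynomials of the thagomizer matroids *)

Section KLThagomizer.
Variables (n : nat) (C : fps {poly int}).
Let y := fpsX {poly int}.
Let t : fps {poly int} := fpsC 'X.
Hypothesis CE : C = 1 + y * C ^+ 2 + (t - 1) * y ^+ 2 * C ^+ 2.
Let M := thagomizer n.

Definition thag_KL (x : thag_flat n) : {poly int} :=
  if x is inr f then C (n - #|spikes f|)%N else 1.

(** For [inl U] this is t^d = (1 + (t - 1))^d. For [inr f] it is [reverse_dyck_poly] at d = n - j,
    with j the support size: the sets sum to (t - 1)(1 + (t - 2))^d, and 2^k C(d,k) partial maps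
    have k new vertices. *)
Lemma thag_KL_identity x : reverse (n.+1 - flat_rank x) (thag_KL x) =
  \sum_(z | flat_le x z) thag_kernel x z * thag_KL z.
Proof.
have leC (V : {set 'I_n}) : (#|V| <= n)%N by rewrite -[leqRHS]card_ord max_card.
case: x => [U|f] /=; rewrite big_sumType /=.
  rewrite [X in _ + X]big_pred0_eq addr0 subSS.
  transitivity (\sum_(V : {set 'I_n} | (U \subset V) && (V \subset setT))
      ('X - 1 : {poly int}) ^+ (#|V| - #|U|)).
    rewrite (big_interval_card (fun m => ('X - 1) ^+ (m - #|U|))) ?subsetT //.
    under eq_bigr => k _ do rewrite addKn.
    rewrite sum_binomial addrC subrK cardsT card_ord.
    by rewrite -(reverseXn (leqnn _)) subnn.
  apply: eq_big => [V|V]; rewrite ?subsetT ?andbT // => sUV.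
  by rewrite thag_kernel_inl // mulr1.
rewrite subSn // (reverse_dyck_poly CE); congr (_ + _).
  transitivity (('X - 1) * \sum_(V : {set 'I_n} | (spikes f \subset V) && (V \subset setT))
      ('X - 2%:R : {poly int}) ^+ (#|V| - #|spikes f|)).
    rewrite (big_interval_card (fun m => ('X - 2%:R) ^+ (m - #|spikes f|))) ?subsetT //.
    under eq_bigr => k _ do rewrite addKn.
    rewrite sum_binomial cardsT card_ord exprS; congr (_ * _ ^+ _); ring.
  rewrite mulr_sumr; apply: eq_big => [V|V]; rewrite ?subsetT ?andbT // => sfV.
  by rewrite thag_kernel_inrl // mulr1.
transitivity (\sum_(g | flat_le (inr f) (inr g) && (spikes g \subset setT))
    ('X - 1 : {poly int}) ^+ (#|spikes g| - #|spikes f|) * C (n - #|spikes g|)%N); last first.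
  apply: eq_big => [g|g]; rewrite subsetT ?andbT // => fg.
  by rewrite thag_kernel_inr.
have -> := big_extensions_card (fun m => ('X - 1) ^+ (m - #|spikes f|) * C (n - m)%N)
  (subsetT (spikes f)).
rewrite cardsT card_ord; apply: eq_bigr => k _.
rewrite addKn subnDA mulrnA; congr (_ *+ _).
by rewrite exprMn -natrX mulr_natl mulrnAl.
Qed.

Lemma KL_thagomizer_series : KL_thagomizer n = C n.
Proof.
(* The empty partial map labels the empty flat, and contracting it gives back [M]. *)
have flat0 : edges_of (inr [ffun=> None] : thag_flat n) = set0.
  have : rk M (edges_of (inr [ffun=> None] : thag_flat n)) = 0%N.
    rewrite rk_edges_of /= (_ : spikes _ = set0) ?cards0 //.
    by apply/setP => i; rewrite !inE ffunE.
  rewrite rk_indep ?inE ?acyclic_edges_of ?(@edges_of_sub n) // => /eqP.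
  by rewrite cards_eq0 => /eqP.
pose Q (F : {set {set bool + 'I_n}}) := thag_KL (flat_of F).
rewrite /KL_thagomizer -[thagomizer n]contraction0 -flat0.
have rkM x : (rank M - rk M (edges_of x) = n.+1 - flat_rank x)%N.
  by rewrite rank_thagomizer rk_edges_of.
rewrite (@KL_poly_contraction _ M Q); rewrite ?edges_of_flat //.
- rewrite /Q edges_ofK /= (_ : spikes _ = set0) ?cards0 ?subn0 //.
  by apply/setP => i; rewrite !inE ffunE.
- move=> _ /flats_thagomizer[x ->]; rewrite /Q edges_ofK rk_edges_of rank_thagomizer.
  case: x => //= f e; have := max_card (mem (spikes f)); rewrite card_ord e ltnn //.
- move=> _ /flats_thagomizer[x ->]; rewrite /Q edges_ofK rk_edges_of rank_thagomizer.
  case: x => [U|f] /=; first by rewrite size_poly1 muln0 subn_gt0.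
  move=> lt; apply: leq_ltn_trans (size_dyck_series CE _) _.
  by rewrite subSn.
move=> _ /flats_thagomizer[x ->]; rewrite /Q edges_ofK rkM thag_KL_identity.
rewrite big_flats_thagomizer; apply: eq_big => [z|z xz]; first by rewrite edges_ofS.
rewrite edges_ofK; congr (_ * _).
rewrite (@big_flats_thagomizer n _
  (fun H => (edges_of x \subset H) && (H \subset edges_of z))).
apply: eq_big => [b|b /andP[xb bz]]; first by rewrite !edges_ofS.
by rewrite !rk_edges_of mobius_thagomizer.
Qed.

End KLThagomizer.

Theorem theorem1p1 :
  (forall n k : nat,
     (KL_thagomizer n)`_k
       = #|[set w : (2 * n).-tuple bool | dyck w & long_ascents w == k]|%:Z)
  /\
  (let u : fps {poly rat} := fpsX {poly rat} in
   let t : fps {poly rat} := fpsC 'X in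
   fps_map (map_poly intr) KL_series
     = (1 - fps_sqrt (1 - 4%:R * u * (1 - u + t * u)))
       / (2%:R * (1 - u + t * u))).
Proof.
have [C CE] := dyck_series_exists.
split=> [n k|]; first by rewrite (KL_thagomizer_series n CE) (dyck_series_count CE).
apply: etrans (dyck_series_sqrt CE); congr fps_map.
by apply: fpsP => -[|n]; rewrite fps_coefXM //= (KL_thagomizer_series n CE).
Qed.
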